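(* Let $k\ge2$ and $n\ge1$. As maps on $k$-Dyck paths of size $n$, $$\widehat{RSK}=\partial^{-(n-1)}\circ\mathrm{Mat},$$ where $\partial$ is promotion, $\mathrm{Mat}$ is the matching map, and $\widehat{RSK}$ is the inverse of the map $\widehat{RSK}^{-1}$ defined via maximal $k$-Dyck tilings in the context.
   Context: A $k$-Dyck path of size $n$ is a lattice path from $(0,0)$ to $(kn,n)$ with steps $U=(0,1)$, $R=(1,0)$, weakly above $y=x/k$, identified with its word of length $N=(k+1)n$. Promotion: the toggle $t_i$ ($1\le i\le N-1$) exchanges the $i$-th and $(i+1)$-st letters if the result is a $k$-Dyck path and otherwise fixes the path; $\partial=t_{N-1}\cdots t_2t_1$ ($t_1$ applied first). Matching map: write $\bar i=N+1-i$ for $1\le i\le n$ (''barred''). Number the rows of $p$ by $1,\dots,n$ from the top. Set $k_i=kn-j+1$ if the up step in the $i$-th row is immediately preceded by a right step, lying in the $j$-th column from the left; otherwise $k_i=\bar i$. Starting with $I=[1,N]$, for $i=1,\dots,n$ let $T_i$ be the set of $k+1$ successive elements of $I$ starting from $k_i$, in decreasing order if $k_i$ is unbarred and in increasing order if barred (cyclically modulo $N$), and replace $I$ by $I\setminus T_i$. $\mathrm{Mat}(p)$ is the $k$-Dyck path with up steps at positions $\min T_1,\dots,\min T_n$. Perfect matching $S(P)$ of a $k$-Dyck path: processing the up steps from the last to the first, the block of an up step at position $u$ consists of $u$ and the $k$ smallest positions $>u$ of right steps not yet used. It consists of $n$ blocks of $k+1$ integers. $k$-Dyck tilings: a $k$-Dyck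 tile is a ribbon of unit boxes whose centres, read from bottom left to top right, form a $k$-Dyck path (possibly of size $0$, a single box). A $k$-Dyck tiling above $P$ is a tiling by $k$-Dyck tiles of the region above $P$ and below the top path $U^nR^{kn}$. It is cover-inclusive if every tile translated by $(1,-1)$ lies below $P$ or is contained in another tile (so sizes weakly decrease from bottom to top). It is maximal if its tiles have the largest size: there is no other cover-inclusive tiling of the same region such that every tile of the given one is contained in a tile of the other. The map $\widehat{RSK}^{-1}:P\mapsto Q$: let $D$ be the maximal cover-inclusive $k$-Dyck tiling above $P$. Order its tiles $d_1,\dots,d_m$ from bottom to top so that, with $\lambda_0=P$, the tile $d_p$ lies just above $\lambda_{p-1}$ and $\lambda_p$ is the lowest path above $\lambda_{p-1}$ and $d_p$. If the south-most edge of $d_p$ is the $i_p$-th step of $\lambda_{p-1}$ and its rightmost edge is the $j_p$-th step, exchange the integers $i_p$ and $j_p$ in the blocks of $S(P)$, successively for $p=1,\dots,m$. This gives a collection $\widehat S(P)$ of $n$ sets in which $1,\dots,n$ belong to distinct blocks. Let $S_i$ be the block containing $i$ ($1\le i\le n$) and $S_i'=S_i\setminus\{i\}$. Put $$\kappa_i=\#\Big\{j\in\bigcup_{1\le l\le n-i}S'_l:\ j<\min S'_{n+1-i}\Big\},\qquad y_i=(n-i)k-\kappa_i\qquad(1\le i\le n),$$ and $y_1^{\max}=y_1$, $y_i^{\max}=\min\{y_{i-1}^{\max},y_i\}$ for $2\le i\le n$. Then $Q$ is the $k$-Dyck path such that the region above $Q$ and below the top path is the Young diagram with rows, from the top, of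 lengths $y_1^{\max},\dots,y_n^{\max}$. *)

(* Defs.v *)
From HB Require Import structures.
From mathcomp Require Import all_boot perm.

Set Implicit Arguments.
Unset Strict Implicit.
Unset Printing Implicit Defensive.

(* Letters, rows, columns and integers in blocks are numbered from 1, as in   *)
(* [1, N]; only the coordinates of lattice points and boxes start from 0.     *)

Definition up : bool := true.
Definition right : bool := false.

Definition letter (w : seq bool) (i : nat) : bool := nth right w i.-1.

Definition step_start (w : seq bool) (i : nat) : nat * nat :=
  (count_mem right (take i.-1 w), count_mem up (take i.-1 w)).

Definition is_step (w : seq bool) (i : nat) (s : bool) (a : nat * nat) : bool :=
  [&& 0 < i <= size w, letter w i == s & step_start w i == a].

Definition up_positions (w : seq bool) : seq nat :=
  [seq i <- iota 1 (size w) | letter w i == up].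

Definition right_positions (w : seq bool) : seq nat :=
  [seq i <- iota 1 (size w) | letter w i == right].

(* A lattice point (x, y) is weakly above the line y = x / k iff x <= k * y.  *)
Definition is_kdyck (k n : nat) (w : seq bool) : bool :=
  [&& count_mem up w == n, count_mem right w == k * n &
      all (fun m => count_mem right (take m w) <= k * count_mem up (take m w))
          (iota 0 (size w).+1)].

Record dyck (k n : nat) : Type := Dyck {
  word :> (k.+1 * n).-tuple bool;
  wordP : is_kdyck k n word }.

HB.instance Definition _ (k n : nat) := [isSub for @word k n].
HB.instance Definition _ (k n : nat) := [Finite of dyck k n by <:].

Definition exchange (i j x : nat) : nat :=
  if x == i then j else if x == j then i else x.

Definition min_seq (s : seq nat) : nat := foldr minn (head 0 s) s.

Definition swap_letters (N i : nat) (w : N.-tuple bool) : N.-tuple bool :=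
  [tuple of [seq letter w (exchange i i.+1 x) | x <- iota 1 N]].

Definition toggle (k n i : nat) (p : dyck k n) : dyck k n :=
  insubd p (swap_letters i (word p)).

Definition promotion_fun (k n : nat) (p : dyck k n) : dyck k n :=
  foldl (fun q i => toggle i q) p (iota 1 (k.+1 * n).-1).

Lemma exchangeK i j : involutive (exchange i j).
Proof.
move=> x; rewrite /exchange.
by case: (eqVneq x i) => [->|xi]; case: (eqVneq x j) => [xj|xj];
  rewrite ?eqxx // ?(negPf xi) ?(negPf xj) //; case: eqVneq.
Qed.

Lemma nth_swap_letters N i (w : N.-tuple bool) j : j < N ->
  nth right (swap_letters i w) j = letter w (exchange i i.+1 j.+1).
Proof.
by move=> jN; rewrite (nth_map 0) ?size_iota // nth_iota // add1n.
Qed.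

Lemma swap_lettersK N i (w : N.-tuple bool) : 0 < i < N ->
  swap_letters i (swap_letters i w) = w.
Proof.
case/andP=> i0 iN; apply/val_inj/(@eq_from_nth _ right); first by rewrite !size_tuple.
move=> j; rewrite size_tuple => jN; rewrite nth_swap_letters // /letter.
have [e0 eN] : 0 < exchange i i.+1 j.+1 /\ exchange i i.+1 j.+1 <= N.
  by rewrite /exchange; case: eqP => // _; case: eqP => // _; split=> //; apply: ltnW.
by rewrite nth_swap_letters ?prednK // exchangeK.
Qed.

Lemma toggleK k n i : 0 < i < k.+1 * n -> involutive (@toggle k n i).
Proof.
move=> iN p; rewrite /toggle.
have [d|d] := boolP (is_kdyck k n (swap_letters i (word p))).
  apply/val_inj; rewrite !val_insubd d swap_lettersK //.
  by rewrite (wordP p).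
have -> : insubd p (swap_letters i (word p)) = p.
  by apply/val_inj; rewrite val_insubd (negPf d).
by apply/val_inj; rewrite val_insubd (negPf d).
Qed.

Lemma promotion_inj k n : injective (@promotion_fun k n).
Proof.
rewrite /promotion_fun.
have : all (fun i => 0 < i < k.+1 * n) (iota 1 (k.+1 * n).-1).
  apply/allP=> i; rewrite mem_iota => /andP[i0].
  by rewrite add1n i0; case: (k.+1 * n) => //=; case: i i0.
elim: (iota _ _) => [_ p q //|i s IHs /= /andP[iN sN] p q].
by move/(IHs sN)/(inv_inj (toggleK iN)).
Qed.

Definition promotion (k n : nat) : {perm dyck k n} := perm (@promotion_inj k n).

(* Row i is counted from the top, so its up step is the i-th one from the end.*)
Definition row_up (w : seq bool) (i : nat) : nat :=
  nth 0 (rev (up_positions w)) i.-1.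

(* The second component tells whether the integer k_i is barred.              *)
Definition mat_start (k n : nat) (p : dyck k n) (i : nat) : nat * bool :=
  let u := row_up p i in
  if (1 < u) && (letter p u.-1 == right)
  then (k * n - count_mem right (take u.-1 p) + 1, false)
  else (k.+1 * n + 1 - i, true).

Definition cyclic_from (N : nat) (c : nat * bool) : seq nat :=
  if c.2 then rot c.1.-1 (iota 1 N) else rev (rot c.1 (iota 1 N)).

Definition successive (k N : nat) (I : seq nat) (c : nat * bool) : seq nat :=
  take k.+1 [seq x <- cyclic_from N c | x \in I].

Fixpoint mat_blocks_from (k N : nat) (I : seq nat) (cs : seq (nat * bool)) :
    seq (seq nat) :=
  if cs is c :: cs' then
    let T := successive k N I c in
    T :: mat_blocks_from k N [seq x <- I | x \notin T] cs'
  else [::].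

Definition mat_blocks (k n : nat) (p : dyck k n) : seq (seq nat) :=
  mat_blocks_from k (k.+1 * n) (iota 1 (k.+1 * n))
    [seq mat_start p i | i <- iota 1 n].

Definition mat_word (k n : nat) (p : dyck k n) : (k.+1 * n).-tuple bool :=
  [tuple of [seq if x \in [seq min_seq T | T <- mat_blocks p] then up else right
            | x <- iota 1 (k.+1 * n)]].

Lemma min_seq_mem s : s != [::] -> min_seq s \in s.
Proof.
have H x0 t : foldr minn x0 t \in x0 :: t.
  elim: t => [|y t IHt] /=; first by rewrite mem_head.
  rewrite /minn; case: ifP => _; first by rewrite !inE eqxx orbT.
  by move: IHt; rewrite !inE; case/orP=> ->; rewrite ?orbT.
case: s => // x s _; have := H x (x :: s).
by rewrite /min_seq !inE /= orbA orbb.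
Qed.

Lemma min_seq_le s x : x \in s -> min_seq s <= x.
Proof.
rewrite /min_seq; elim: s {1}(head 0 s) => //= y s IHs x0.
rewrite inE => /orP[/eqP<-|/IHs xs]; first exact: geq_minl.
exact: leq_trans (geq_minr _ _) (xs _).
Qed.

Lemma cyclic_from_perm N c : perm_eq (cyclic_from N c) (iota 1 N).
Proof.
rewrite /cyclic_from; case: ifP => _; first by rewrite perm_rot.
by rewrite perm_rev perm_rot.
Qed.

Lemma mat_blocks_fromP k N I cs :
    uniq I -> {subset I <= iota 1 N} -> size I = k.+1 * size cs ->
  let B := mat_blocks_from k N I cs in
  [/\ size B = size cs, perm_eq (flatten B) I & all (fun T => size T == k.+1) B].
Proof.
elim: cs I => [|c cs IHcs] I uI sI zI /=.
  by move: zI; rewrite muln0 => /size0nil ->.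
set F := [seq x <- cyclic_from N c | x \in I].
have uC : uniq (cyclic_from N c) by rewrite (perm_uniq (cyclic_from_perm N c)) iota_uniq.
have pF : perm_eq F I.
  apply: uniq_perm; rewrite ?filter_uniq // => x; rewrite mem_filter.
  rewrite (perm_mem (cyclic_from_perm N c)).
  by case xI: (x \in I) => //=; apply: sI.
set T := successive k N I c; set I' := filter _ _.
have zT : size T = k.+1.
  by rewrite /T /successive size_takel // -/F (perm_size pF) zI mulnS leq_addr.
have uT : uniq T by rewrite take_uniq // filter_uniq.
have sT x : x \in T -> x \in I by move/mem_take; rewrite -/F (perm_mem pF).
have pI : perm_eq (T ++ I') I.
  apply: uniq_perm => //.
    rewrite cat_uniq uT filter_uniq // andbT /=.
    by apply/hasPn => x; rewrite mem_filter => /andP[].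
  move=> x; rewrite mem_cat mem_filter; case xT: (x \in T) => //=.
  by rewrite sT.
have zI' : size I' = k.+1 * size cs.
  by apply/eqP; rewrite -(eqn_add2l k.+1) -{1}zT -size_cat (perm_size pI) zI mulnS.
have [|||zB pB aB] := IHcs I'; rewrite ?filter_uniq //.
  by move=> x; rewrite mem_filter => /andP[_ /sI].
by rewrite zB zT eqxx aB; split=> //; apply: perm_trans pI; rewrite perm_cat2l.
Qed.

Lemma count_up_right (w : seq bool) : count_mem up w + count_mem right w = size w.
Proof. by rewrite -(count_predC (pred1 up) w); congr addn; apply: eq_count; case. Qed.

Lemma mat_word_dyck k n (p : dyck k n) : is_kdyck k n (mat_word p).
Proof.
set N := k.+1 * n; set B := mat_blocks p.
have [zB pB aB] : [/\ size B = n, perm_eq (flatten B) (iota 1 N)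
                    & all (fun T => size T == k.+1) B].
  have [] // := @mat_blocks_fromP k N (iota 1 N) [seq mat_start p i | i <- iota 1 n].
  - exact: iota_uniq.
  - by rewrite !size_iota size_map size_iota.
  by rewrite size_map size_iota.
have nB T : T \in B -> T != [::] by move/(allP aB); case: T.
have uB : uniq [seq min_seq T | T <- B].
  have: uniq (flatten B) by rewrite (perm_uniq pB) iota_uniq.
  elim: (B) nB => //= T C IHC nC; rewrite cat_uniq => /and3P[_ dTC uC].
  rewrite IHC ?andbT => [|T' T'C|//]; last by apply: nC; rewrite inE T'C orbT.
  apply/mapP=> -[T' T'C eT]; case/hasP: dTC; exists (min_seq T').
    by apply/flattenP; exists T'; rewrite // min_seq_mem // nC // inE T'C orbT.
  by rewrite /= -eT min_seq_mem // nC // mem_head.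
have mB T : T \in B -> 0 < min_seq T <= N.
  move=> TB; have: min_seq T \in flatten B.
    by apply/flattenP; exists T; rewrite // min_seq_mem ?nB.
  by rewrite (perm_mem pB) mem_iota add1n ltnS.
have upE m : m <= N ->
    count_mem up (take m (mat_word p)) = count (fun T => min_seq T <= m) B.
  move=> mN; rewrite /= -map_take take_iota (minn_idPl mN) count_map.
  rewrite (@eq_count _ _ (mem [seq min_seq T | T <- B])); last first.
    by move=> x /=; case: ifP.
  rewrite -size_filter -(count_map min_seq (fun x => x <= m)) -size_filter.
  apply/perm_size/uniq_perm; rewrite ?filter_uniq ?iota_uniq // => x.
  rewrite !mem_filter mem_iota add1n ltnS /=.
  apply/andP/andP=> -[]; first by move=> -> /andP[_ ->].
  by move=> -> xB; rewrite xB andbT; case/mapP: xB => T /mB /andP[x0 _] ->.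
have tot m : m <= N -> m <= k.+1 * count (fun T => min_seq T <= m) B.
  move=> mN; have {1}<- : count (fun x => x <= m) (flatten B) = m.
    rewrite (seq.permP pB) -size_filter -[RHS](size_iota 1).
    apply/perm_size/uniq_perm; rewrite ?filter_uniq ?iota_uniq // => x.
    rewrite mem_filter !mem_iota !add1n !ltnS andbCA.
    by case xm: (x <= m); rewrite ?andbF // (leq_trans xm mN) !andbT.
  elim: (B) aB => //= T C IHC /andP[/eqP zT aC].
  rewrite count_cat mulnDr leq_add ?IHC //.
  case mT: (min_seq T <= m); first by rewrite muln1 -zT count_size.
  rewrite muln0 leqn0 -[_ == 0]negbK -lt0n -has_count; apply/hasPn => x xT.
  by apply: contraFN mT => /= xm; apply: leq_trans (min_seq_le xT) xm.
have upN : count_mem up (mat_word p) = n.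
  have := upE N (leqnn N); rewrite take_oversize ?size_tuple // => ->.
  by rewrite -zB; apply/eqP; rewrite -all_count; apply/allP => T /mB /andP[_].
rewrite /is_kdyck upN eqxx andTb; apply/andP; split.
  by rewrite -(eqn_add2l n) -{1}upN count_up_right size_tuple mulSn.
apply/allP=> m; rewrite mem_iota add0n size_tuple ltnS => mN.
have := tot m mN; rewrite -(upE _ mN) mulSn.
have {1}-> : m = size (take m (mat_word p)) by rewrite size_takel ?size_tuple.
by rewrite -count_up_right leq_add2l.
Qed.

Definition Mat (k n : nat) (p : dyck k n) : dyck k n := Dyck (mat_word_dyck p).

Fixpoint matching_from (k : nat) (rs us : seq nat) : seq (seq nat) :=
  if us is u :: us' then
    let b := take k [seq r <- rs | u < r] in
    (u :: b) :: matching_from k [seq r <- rs | r \notin b] us'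
  else [::].

Definition matching (k n : nat) (p : dyck k n) : seq (seq nat) :=
  matching_from k (right_positions p) (rev (up_positions p)).

(* The box b is the unit square with lower left corner (b.1, b.2).            *)
Definition box (k n : nat) : finType := ('I_(k * n) * 'I_n)%type.

Definition corner (k n : nat) (b : box k n) : nat * nat := (val b.1, val b.2).

(* Number of boxes, in the row of height y, between the line x = 0 and w.     *)
Definition row_length (w : seq bool) (y : nat) : nat :=
  count_mem right (take (nth 0 (up_positions w) y).-1 w).

Definition region_above (k n : nat) (p : dyck k n) : {set box k n} :=
  [set b : box k n | b.1 < row_length p b.2].

Definition move (a : nat * nat) (s : bool) : nat * nat :=
  if s == up then (a.1, a.2.+1) else (a.1.+1, a.2).

(* The centres of the boxes of d, translated by (-1/2, -1/2), are the lattice *)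
(* points of a k-Dyck path starting from a.                                   *)
Definition is_tile (k n : nat) (d : {set box k n}) : Prop :=
  exists (m : nat) (c : seq bool) (a : nat * nat),
    is_kdyck k m c /\ [seq corner b | b in d] =i a :: scanl move a c.

Definition is_tiling (k n : nat) (p : dyck k n) (D : {set {set box k n}}) : Prop :=
  partition D (region_above p) /\ forall d, d \in D -> is_tile d.

(* b' is b translated by (1, -1). The translate may leave the rectangle, in   *)
(* which case there is no such b'.                                            *)
Definition southeast (k n : nat) (b b' : box k n) : bool :=
  (val b'.1 == b.1.+1) && (val b.2 == b'.2.+1).

Definition cover_inclusive (k n : nat) (p : dyck k n) (D : {set {set box k n}}) :
    Prop :=
  forall d, d \in D ->
    (forall b b', b \in d -> southeast b b' -> b' \notin region_above p) \/
    (exists2 d', d' \in D &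
       forall b, b \in d -> exists2 b', b' \in d' & southeast b b').

Definition maximal_cover_inclusive (k n : nat) (p : dyck k n)
    (D : {set {set box k n}}) : Prop :=
  [/\ is_tiling p D, cover_inclusive p D &
      ~ exists D' : {set {set box k n}},
          [/\ D' != D, is_tiling p D', cover_inclusive p D' &
              forall d, d \in D -> exists2 d', d' \in D' & d \subset d']].

(* The boxes between p and p' are exactly those of d: the tile d lies just    *)
(* above p, and p' is the lowest path above p and d.                          *)
Definition add_tile (k n : nat) (p : dyck k n) (d : {set box k n})
    (p' : dyck k n) : Prop :=
  d \subset region_above p /\ region_above p' = region_above p :\: d.

Definition southmost_edge (k n : nat) (p : dyck k n) (d : {set box k n})
    (i : nat) : Prop :=
  exists b, [/\ b \in d, forall b', b' \in d -> b.2 <= b'.2 &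
                is_step p i right (corner b)].

Definition rightmost_edge (k n : nat) (p : dyck k n) (d : {set box k n})
    (j : nat) : Prop :=
  exists b, [/\ b \in d, forall b', b' \in d -> b'.1 <= b.1 &
                is_step p j up (b.1.+1, val b.2)].

Definition exchange_blocks (i j : nat) (B : seq (seq nat)) : seq (seq nat) :=
  [seq [seq exchange i j x | x <- T] | T <- B].

(* add_tiles p B ds B': adding the tiles ds successively above p turns the    *)
(* blocks B into B'.                                                          *)
Inductive add_tiles (k n : nat) :
    dyck k n -> seq (seq nat) -> seq {set box k n} -> seq (seq nat) -> Prop :=
| AddNil p B : add_tiles p B [::] B
| AddCons p p' d ds i j B B' of
    add_tile p d p' & southmost_edge p d i & rightmost_edge p d j &
    add_tiles p' (exchange_blocks i j B) ds B' : add_tiles p B (d :: ds) B'.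

Definition Sprime (B : seq (seq nat)) (i : nat) : seq nat :=
  [seq x <- nth [::] B (find (fun T => i \in T) B) | x != i].

Definition kappa (k n : nat) (B : seq (seq nat)) (i : nat) : nat :=
  count (fun j => has (fun l => j \in Sprime B l) (iota 1 (n - i))
                  && (j < min_seq (Sprime B (n + 1 - i))))
        (iota 1 (k.+1 * n)).

Definition yrow (k n : nat) (B : seq (seq nat)) (i : nat) : nat :=
  (n - i) * k - kappa k n B i.

(* Only the values at i >= 1 are meaningful.                                  *)
Fixpoint ymax (k n : nat) (B : seq (seq nat)) (i : nat) : nat :=
  match i with
  | 0 => 0
  | 1 => yrow k n B 1
  | i'.+1 => minn (ymax k n B i') (yrow k n B i)
  end.

(* Q is an image of P, for some choice of the maximal tiling and of the order *)
(* of its tiles. The i-th row from the top is the row of height n - i.        *)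
Definition RSKinv_graph (k n : nat) (P Q : dyck k n) : Prop :=
  exists (D : {set {set box k n}}) (ds : seq {set box k n}) (B : seq (seq nat)),
    [/\ maximal_cover_inclusive P D, uniq ds /\ ds =i D,
        add_tiles P (matching P) ds B &
        forall i, 1 <= i <= n -> row_length Q (n - i) = ymax k n B i].

(* Main.v *)
Require Import Defs.
From mathcomp Require Import all_boot all_fingroup.
From mathcomp Require Import zify.

Set Implicit Arguments.
Unset Strict Implicit.
Unset Printing Implicit Defensive.

(** Both sides are compared through the blocks of the matching S(P), seen as a
noncrossing partition of the positions 1, ..., N.

On the side of promotion, blocks are read off the heights: the right step r
belongs to the last up step before r that starts at most as high as r ends
([partner], [matching_blocks]). In this form promotion rotates the partition by
one position ([partner_promotion]), so the up steps of the (n - 1)-st promotion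
of P are the minima of the blocks of P rotated by n - 1.

On the side of tilings, a box is given by the number m of the point of P on the
diagonal through its south-east corner and by its layer, the number of boxes of
that diagonal between it and P. Layer j is a copy of the factor of P between its
(j + 1)-st right step and its (j + 1)-st up step from the end, and every tile of
a cover-inclusive tiling is a balanced factor in one layer. Balanced factors with
a common point have a balanced union, so each layer splits in one way into
maximal ones, and this is the maximal tiling ([maximal_unique]). Adding the tile
over the points s, ..., t exchanges the letters at positions s and t + 1; what
lies between them is a union of blocks that have not moved yet. The orders in
which the tiles may be added are not compared. Instead [state_step] shows an
invariant that holds along each of them: a block either keeps its last right step
at its place, or keeps its up step at its place and is overtaken by a block with
a higher label. Here the label of a block is the final position of its up step.
The final form of the invariant is [settled].

Let M(l) be the largest final position of a right step whose label is at least l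
([top]). The two kinds of blocks give y_i^max = N - M(n + 1 - i) ([ymax_top]), and
they show that Mat, applied to a path with these row lengths, cuts out the blocks
of P rotated by n - 1 ([stages]). At the row with label l this is the block with
label l - 1 when M(l) = M(l - 1), and the block ending at M(l) otherwise. Hence
Mat Q is the (n - 1)-st promotion of P whenever Q is an image of P. Every P has an
image, since a remaining tile with a suitably low first box can always be added
([next_tile]). As promotion is invertible, finiteness turns the relation between
P and Q into a bijection with the inverse announced. *)

(** * Steps and heights *)


Definition ups (w : seq bool) (m : nat) : nat := count_mem up (take m w).
Definition rights (w : seq bool) (m : nat) : nat := count_mem right (take m w).

(** k times the vertical minus the horizontal coordinate; the subtraction never
truncates on a k-Dyck path, by [dyck_ge]. *)
Definition height (k : nat) (w : seq bool) (m : nat) : nat :=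
  k * ups w m - rights w m.

Section Words.
Variable w : seq bool.

Lemma take_letter m : m < size w -> take m.+1 w = rcons (take m w) (letter w m.+1).
Proof. by move=> mw; rewrite (take_nth right). Qed.

Lemma ups0 : ups w 0 = 0. Proof. by rewrite /ups take0. Qed.

Lemma rights0 : rights w 0 = 0. Proof. by rewrite /rights take0. Qed.

Lemma ups_rights m : m <= size w -> ups w m + rights w m = m.
Proof. by move=> mw; rewrite /ups /rights count_up_right size_takel. Qed.

Lemma ups_up m : m < size w -> letter w m.+1 -> ups w m.+1 = (ups w m).+1.
Proof.
by move=> mw lm; rewrite /ups take_letter // lm -cats1 count_cat /= addn0 addn1.
Qed.

Lemma ups_right m : m < size w -> ~~ letter w m.+1 -> ups w m.+1 = ups w m.
Proof.
move=> mw /negPf lm.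
by rewrite /ups take_letter // lm -cats1 count_cat /= !addn0.
Qed.

Lemma rights_up m : m < size w -> letter w m.+1 -> rights w m.+1 = rights w m.
Proof.
by move=> mw lm; rewrite /rights take_letter // lm -cats1 count_cat /= !addn0.
Qed.

Lemma rights_right m :
  m < size w -> ~~ letter w m.+1 -> rights w m.+1 = (rights w m).+1.
Proof.
move=> mw /negPf lm.
by rewrite /rights take_letter // lm -cats1 count_cat /= addn0 addn1.
Qed.

Lemma leq_ups m1 m2 : m1 <= m2 -> ups w m1 <= ups w m2.
Proof.
by move=> /subnKC <-; rewrite /ups takeD count_cat leq_addr.
Qed.

Lemma leq_rights m1 m2 : m1 <= m2 -> rights w m1 <= rights w m2.
Proof.
by move=> /subnKC <-; rewrite /rights takeD count_cat leq_addr.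
Qed.

Lemma ups_count m : m <= size w -> ups w m = count (letter w) (iota 1 m).
Proof.
elim: m => [|m IHm] mw; first by rewrite ups0.
rewrite -[X in iota 1 X]addn1 iotaD count_cat -IHm ?(ltnW mw) //= addn0 add1n.
by case l: (letter w m.+1); [rewrite (ups_up mw l) addn1 | rewrite (ups_right mw (negbT l)) addn0].
Qed.

End Words.

Section Paths.
Variables k n : nat.
Notation N := (k.+1 * n).
Implicit Types (p q : dyck k n).

Lemma size_dyck p : size p = N. Proof. exact: size_tuple. Qed.

Lemma ups_size p : ups p N = n.
Proof.
rewrite /ups take_oversize ?size_tuple //.
by case/and3P: (wordP p) => /eqP.
Qed.

Lemma rights_size p : rights p N = k * n.
Proof.
rewrite /rights take_oversize ?size_tuple //.
by case/and3P: (wordP p) => _ /eqP.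
Qed.

Lemma dyck_ge p m : m <= N -> rights p m <= k * ups p m.
Proof.
move=> mN; case/and3P: (wordP p) => _ _ /allP; apply.
by rewrite mem_iota size_tuple.
Qed.

Lemma height_eq p m : m <= N -> height k p m + rights p m = k * ups p m.
Proof. by move=> /(dyck_ge p) h; rewrite /height subnK. Qed.

Lemma ups_le p m : m <= N -> ups p m <= n.
Proof. by move/(leq_ups p); rewrite ups_size. Qed.

Lemma rights_le p m : m <= N -> rights p m <= k * n.
Proof. by move/(leq_rights p); rewrite rights_size. Qed.

Lemma ups_stepP p m : m < N ->
  [/\ letter p m.+1, ups p m.+1 = (ups p m).+1 & rights p m.+1 = rights p m] \/
  [/\ ~~ letter p m.+1, ups p m.+1 = ups p m & rights p m.+1 = (rights p m).+1].
Proof.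
move=> mN; have ms : m < size p by rewrite size_dyck.
case l : (letter p m.+1); [left|right].
  by rewrite ups_up ?rights_up ?l.
by rewrite ups_right ?rights_right ?l.
Qed.

Lemma height_stepP p m : m < N ->
  (letter p m.+1 /\ height k p m.+1 = height k p m + k) \/
  (~~ letter p m.+1 /\ height k p m = (height k p m.+1).+1).
Proof.
move=> mN; have := height_eq p mN; have := height_eq p (ltnW mN).
by case: (ups_stepP p mN) => -[l -> ->]; rewrite ?mulnS => *; [left|right]; lia.
Qed.

Lemma height0 p : height k p 0 = 0.
Proof. by rewrite /height ups0 muln0. Qed.

Lemma heightN p : height k p N = 0.
Proof. by rewrite /height ups_size rights_size subnn. Qed.

End Paths.

(** * Blocks of the perfect matching *)

Section Partner.
Variables k n : nat.
Notation N := (k.+1 * n).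
Variable p : dyck k n.
Notation h := (height k p).

(** The up step of the block of x. For an up step x the maximum is x - 1, so that
one formula serves for both letters. *)
Definition partner (x : nat) : nat := (\max_(m < x | h m <= h x) m).+1.

Lemma partnerP x : 0 < x <= N ->
  [/\ 0 < partner x <= x, h (partner x).-1 <= h x &
      forall m, partner x <= m < x -> h x < h m].
Proof.
case/andP=> x0 xN; have h0 : h (Ordinal x0) <= h x by rewrite height0.
rewrite /partner; case: (eq_bigmax_cond (fun m : 'I_x => nat_of_ord m) (A := [pred m : 'I_x | h m <= h x])).
  by apply/card_gt0P; exists (Ordinal x0).
move=> m0; rewrite inE /= => hm0 em.
rewrite em /=; split=> //.
move=> m /andP[mm mx]; rewrite ltnNge; apply/negP => hm.
have := @leq_bigmax_cond _ [pred m : 'I_x | h m <= h x] (fun m : 'I_x => nat_of_ord m) (Ordinal mx) hm.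
by rewrite em /= leqNgt mm.
Qed.

Lemma partner_uniq x u : 0 < x <= N -> 0 < u <= x -> h u.-1 <= h x ->
  (forall m, u <= m < x -> h x < h m) -> partner x = u.
Proof.
move=> xN ux hu hm; have [px hp hpm] := partnerP xN.
case: (ltngtP (partner x) u) => // c.
  by have := hpm u.-1; lia.
by have := hm (partner x).-1; lia.
Qed.

Lemma partner_up x : 0 < x <= N -> letter p x -> partner x = x.
Proof.
case: x => // x xN lx; apply: partner_uniq => //; try lia.
by case: (height_stepP p xN) => -[l /= e]; [lia|rewrite lx in l].
Qed.

Lemma partner_right x : 0 < x <= N -> ~~ letter p x -> partner x < x.
Proof.
case: x => // x xN lx; have [px hp hpm] := partnerP xN.
rewrite ltn_neqAle; case/andP: px => _ ->; rewrite andbT; apply/eqP => e.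
move: hp; rewrite e /=.
by case: (height_stepP p xN) => -[l /= e']; [rewrite l in lx|lia].
Qed.

Lemma letter_partner x : 0 < x <= N -> letter p x = (partner x == x).
Proof.
move=> xN; case l: (letter p x); first by rewrite partner_up ?eqxx.
by rewrite ltn_eqF // partner_right // l.
Qed.

Lemma partner_letter x : 0 < x <= N -> letter p (partner x).
Proof.
move=> xN; case: (boolP (letter p x)) => [l|nl]; first by rewrite partner_up.
have [px hp hpm] := partnerP xN; have pr := partner_right xN nl.
have {}hpm := hpm (partner x); have pN : (partner x).-1 < N by lia.
case: (height_stepP p pN) => -[l e]; first by rewrite prednK in l; lia.
rewrite prednK in l e; lia.
Qed.

Lemma partner_idem x : 0 < x <= N -> partner (partner x) = partner x.
Proof.
move=> xN; have [px _ _] := partnerP xN.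
by apply: partner_up; [lia | exact: partner_letter].
Qed.

Definition balanced (s t : nat) : Prop :=
  [/\ s <= t <= N, h t = h s & forall m, s <= m <= t -> h s <= h m].

(** The height decreases by at most one at each step and ends at 0, so it takes
every value below h u after u; where it does so first, the step is a right one. *)
Lemma hit_exists u c : 0 < u <= N -> c < h u ->
  exists t, [/\ u < t <= N, ~~ letter p t, h t = c & forall m, u <= m < t -> c < h m].
Proof.
move=> uN cu.
have ex : exists m, (u <= m <= N) && (h m <= c).
  by exists N; rewrite heightN; lia.
case: (ex_minnP ex) => t /andP[utN ht] tmin.
have ut : u < t.
  by rewrite ltn_neqAle; case: eqP => [e|_]; [rewrite e in cu|]; lia.
have hm m : u <= m < t -> c < h m.
  by move=> um; have := tmin m; lia.
exists t; case: t => // t in utN ht tmin ut hm *.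
have tN : t < N by lia.
have := hm t; case: (height_stepP p tN) => -[l e] ht'; split=> //; try lia.
Qed.

(** For an up step u this is the first return to the height before u, by
[last_ofP]; the maximum makes it total. *)
Definition last_of (u : nat) : nat :=
  \max_(x < N.+1 | (0 < x) && (partner x == u)) x.

Lemma height_up u : 0 < u <= N -> letter p u -> h u = h u.-1 + k.
Proof.
case: u => // u uN l; case: (height_stepP p uN) => -[l' /= e] //.
by rewrite l in l'.
Qed.

Hypothesis k0 : 0 < k.

Lemma last_ofP u : 0 < u <= N -> letter p u ->
  [/\ partner (last_of u) = u, u < last_of u <= N, ~~ letter p (last_of u),
      balanced u.-1 (last_of u) &
      (forall m, u <= m < last_of u -> h u.-1 < h m) /\
      forall x, 0 < x <= N -> partner x = u -> u <= x <= last_of u].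
Proof.
move=> uN lu; have hu := height_up uN lu.
have [|t [utN lt ht hm]] := @hit_exists u (h u.-1) uN; first lia.
have pt : partner t = u by apply: partner_uniq; rewrite ?ht //; lia.
have tmax x : 0 < x <= N -> partner x = u -> u <= x <= t.
  move=> xN px; have [px' hp hpm] := partnerP xN; rewrite px in px' hp hpm.
  by have := hpm t; lia.
have -> : last_of u = t.
  apply/eqP; rewrite eqn_leq; apply/andP; split.
    by apply/bigmax_leqP => x /andP[x0 /eqP px]; have := tmax x; have := ltn_ord x; lia.
  have tN : t < N.+1 by lia.
  pose A := [pred x : 'I_N.+1 | (0 < x) && (partner x == u)].
  have := @leq_bigmax_cond _ A (fun m : 'I_N.+1 => nat_of_ord m) (Ordinal tN).
  by apply; rewrite /= pt eqxx andbT; lia.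
split=> //; split=> //; first lia.
move=> m mt; have := hm m; case: (ltngtP m t) => [||->]; try lia.
case: (ltngtP m u.-1) => [||->]; lia.
Qed.

(** Inside a balanced factor the height stays above its value h s = h t at the two
ends, so the partner of a step cannot precede s, and the first return that ends a
block comes at t at the latest. *)
Lemma balanced_block s t x : balanced s t -> s < x <= t ->
  s < partner x /\ last_of (partner x) <= t.
Proof.
case=> stN hst hm xst; have xN : 0 < x <= N by lia.
have [px hp hpm] := partnerP xN.
have sp : s < partner x.
  by rewrite ltnNge; apply/negP => ps; have := hpm s; have := hm x; lia.
have pN : 0 < partner x <= N by lia.
have [_ _ _ _ [hl _]] := last_ofP pN (partner_letter xN).
split=> //; rewrite leqNgt; apply/negP => tl.
by have := hl t; have := hm (partner x).-1; lia.
Qed.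

Lemma balanced_block_mem s t x y : balanced s t -> s < x <= t ->
  0 < y <= N -> partner y = partner x -> s < y <= t.
Proof.
move=> b xst yN e; have [stN _ _] := b; have xN : 0 < x <= N by lia.
have [px hp hpm] := partnerP xN; have pN : 0 < partner x <= N by lia.
have [_ _ _ _ [_ /(_ y yN e)]] := last_ofP pN (partner_letter xN).
have := balanced_block b xst; lia.
Qed.

(** A block spans a balanced factor, so this is [balanced_block] once more. *)
Lemma noncrossing u x : 0 < u <= N -> letter p u -> u < x < last_of u ->
  partner x <> u -> u < partner x /\ last_of (partner x) < last_of u.
Proof.
move=> uN lu xu px; have [pl ul _ b _] := last_ofP uN lu.
have xst : u.-1 < x <= last_of u by lia.
have [p1 p2] := balanced_block b xst; split; first lia.
rewrite ltn_neqAle p2 andbT; apply/eqP => e.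
have xN : 0 < x <= N by lia.
have [px' hp hpm] := partnerP xN; have pN : 0 < partner x <= N by lia.
by have [ppl _ _ _ _] := last_ofP pN (partner_letter xN); case: px; rewrite -ppl e.
Qed.

Definition block (u : nat) : seq nat := [seq x <- iota 1 N | partner x == u].

Lemma mem_block u x : (x \in block u) = (0 < x <= N) && (partner x == u).
Proof. by rewrite mem_filter mem_iota andbC add1n ltnS. Qed.

Lemma block_cons u : 0 < u <= N -> letter p u ->
  block u = u :: [seq x <- right_positions p | partner x == u].
Proof.
move=> uN lu.
rewrite /block /right_positions size_dyck -filter_predI.
have -> : iota 1 N = iota 1 u.-1 ++ iota u 1 ++ iota u.+1 (N - u).
  have {1}-> : N = u.-1 + (1 + (N - u)) by lia.
  by rewrite !iotaD; do ![congr (_ ++ _)]; congr iota; lia.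
rewrite !filter_cat.
have low P : [seq x <- iota 1 u.-1 | P x && (partner x == u)] = [::].
  rewrite -(filter_pred0 (iota 1 u.-1)); apply: eq_in_filter => x.
  rewrite mem_iota => xu; have xN : 0 < x <= N by lia.
  by have [px _ _] := partnerP xN; rewrite [_ == u]ltn_eqF ?andbF //; lia.
rewrite (low xpredT) /=.
have -> : [seq x <- iota 1 u.-1 | (partner x == u) && (letter p x == right)] = [::].
  by rewrite -(low (fun x => letter p x == right)); apply: eq_filter => x; rewrite andbC.
rewrite /= partner_up // eqxx lu /=; congr (_ :: _).
apply: eq_in_filter => x; rewrite mem_iota => xu.
have xN : 0 < x <= N by lia.
rewrite /= -[letter p x == right]/(letter p x == false) eqbF_neg letter_partner //.
by case: eqP => //= ->; rewrite ltn_eqF //; lia.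
Qed.

(** The right steps of the block of u end at the k heights h u - 1, ..., h u - k,
each of them once. *)
Lemma size_block u : 0 < u <= N -> letter p u -> size (block u) = k.+1.
Proof.
move=> uN lu; rewrite block_cons //=; congr _.+1.
set s := filter _ _; have hu := height_up uN lu.
have rs x : x \in s = [&& 0 < x <= N, ~~ letter p x & partner x == u].
  rewrite mem_filter mem_filter mem_iota size_dyck add1n ltnS.
  by case: (letter p x); case: (partner x == u); case: (0 < x <= N).
have us : uniq s by rewrite !filter_uniq ?iota_uniq.
have := size_iota (h u.-1) k; move=> {1}<-; rewrite -(size_map h s).
apply/perm_size/uniq_perm; rewrite ?iota_uniq //.
  rewrite map_inj_in_uniq // => x y; rewrite !rs => /and3P[xN _ /eqP px] /and3P[yN _ /eqP py] e.
  have [px' _ hpx] := partnerP xN; have [py' _ hpy] := partnerP yN.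
  rewrite px in px' hpx; rewrite py in py' hpy.
  by case: (ltngtP x y) => // c; [have := hpy x|have := hpx y]; lia.
move=> c; rewrite mem_iota; apply/mapP/idP => [[x]|cu].
  rewrite rs => /and3P[xN lx /eqP px] ->; have [px' hp hpx] := partnerP xN.
  rewrite px in px' hp hpx; have := partner_right xN lx; rewrite px => ux.
  by have := hpx u; lia.
have [|t [utN lt ht hm]] := @hit_exists u c uN; first lia.
exists t => //; rewrite rs lt /=.
have tN : 0 < t <= N by lia.
by rewrite tN /= (@partner_uniq t u) //; rewrite ?ht //; lia.
Qed.

End Partner.


Lemma sorted_filterC (s : seq nat) (a : pred nat) :
  sorted ltn s -> {in s &, forall x y, a x -> ~~ a y -> x < y} ->
  s = filter a s ++ filter (predC a) s.
Proof.
move=> ss lt_a; apply: (irr_sorted_eq ltn_trans ltnn) => //; last first.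
  by move=> x; rewrite mem_cat !mem_filter /=; case: (a x); rewrite ?orbF.
have pss := ss; rewrite (sorted_pairwise ltn_trans) in pss.
rewrite (sorted_pairwise ltn_trans) pairwise_cat !pairwise_filter // !andbT.
apply/allrelP => x y; rewrite !mem_filter /= => /andP[ax xs] /andP[ay ys].
exact: lt_a.
Qed.

Section Matching.
Variables k n : nat.
Notation N := (k.+1 * n).
Variable p : dyck k n.
Hypothesis k0 : 0 < k.
Notation h := (height k p).
Notation partner := (partner p).
Notation block := (block p).

Lemma mem_right_positions x : (x \in right_positions p) = (0 < x <= N) && ~~ letter p x.
Proof.
by rewrite mem_filter mem_iota size_dyck add1n ltnS andbC; case: (letter p x).
Qed.

Lemma mem_up_positions x : (x \in up_positions p) = (0 < x <= N) && letter p x.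
Proof.
by rewrite mem_filter mem_iota size_dyck add1n ltnS andbC; case: (letter p x).
Qed.

(** This is why taking the k smallest unused right steps after u is right: the
steps with a partner beyond u have been used, and those with a partner before u
come too late. *)
Lemma partner_lt_block u r r' : 0 < r <= N -> 0 < r' <= N ->
  partner r = u -> partner r' < u < r' -> r < r'.
Proof.
move=> rN rN' pr pr'; have [px hp hpm] := partnerP p rN.
have [px' hp' hpm'] := partnerP p rN'; rewrite pr in px hp hpm.
rewrite ltnNge; apply/negP => rr.
have := hpm' u.-1; have := hpm r'.
case: (ltngtP r' r) rr => [_ _|//|e _]; first lia.
by subst r'; rewrite pr in pr'; lia.
Qed.

Lemma matching_from_blocks us rs : sorted gtn us ->
  {subset us <= up_positions p} ->
  rs = [seq r <- right_positions p | partner r \in us] ->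
  matching_from k rs us = [seq block u | u <- us].
Proof.
elim: us rs => //= u us IHus rs su usP ers.
have uU : u \in up_positions p by apply: usP; rewrite mem_head.
have := uU; rewrite mem_up_positions => /andP[uN lu].
have gtu x : x \in us -> x < u.
  by move: su; rewrite (path_sortedE (rev_trans ltn_trans)) => /andP[/allP h' _] /h'.
have bE : take k [seq r <- rs | u < r] = [seq r <- right_positions p | partner r == u].
  have sb : size [seq r <- right_positions p | partner r == u] = k.
    by have := size_block k0 uN lu; rewrite block_cons //= => -[].
  have rsE : [seq r <- rs | u < r] =
      [seq r <- right_positions p | (u < r) && (partner r \in u :: us)].
    by rewrite ers -filter_predI.
  rewrite rsE (@sorted_filterC (filter _ _) (fun r => partner r == u)).
  - have eA : [seq x <- right_positions p | predI (fun r => partner r == u)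
        (fun r => (u < r) && (partner r \in u :: us)) x] =
      [seq r <- right_positions p | partner r == u].
      apply: eq_in_filter => r; rewrite mem_right_positions => /andP[rN lr] /=.
      case: eqP => //= e; rewrite e mem_head andbT -e.
      by rewrite partner_right.
    by rewrite -[filter (fun r => partner r == u) _]filter_predI eA -{1}sb take_size_cat.
  - by rewrite !(sorted_filter ltn_trans) // (iota_ltn_sorted 1).
  move=> x y; rewrite !mem_filter !inE !mem_iota size_dyck.
  move=> /andP[/andP[ux _] /andP[_ xN]] /andP[/andP[uy py] /andP[_ yN]] /eqP px npy.
  apply: (@partner_lt_block u); rewrite ?px //; try lia.
  by rewrite (negPf npy) in py; rewrite gtu.
rewrite bE block_cons // IHus //.
- by case: (us) su => //= v us' /andP[].
- by move=> x xu; apply: usP; rewrite inE xu orbT.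
rewrite ers -filter_predI; apply: eq_in_filter => r rR /=.
rewrite mem_filter rR andbT inE; case: eqP => //= e.
by symmetry; apply/negP => /gtu; rewrite e ltnn.
Qed.

Lemma matching_blocks : matching p = [seq block u | u <- rev (up_positions p)].
Proof.
apply: matching_from_blocks.
- by rewrite rev_sorted (sorted_filter ltn_trans) // iota_ltn_sorted.
- by move=> x; rewrite mem_rev.
symmetry; apply/all_filterP/allP => r; rewrite mem_right_positions => /andP[rN _].
rewrite mem_rev mem_up_positions partner_letter // andbT.
by have [] := partnerP p rN; lia.
Qed.

End Matching.

Section Exchange.

(** Exchanging two letters changes the path only between them, by one up step. *)
Lemma ups_exchange (w w' : seq bool) i j m : size w' = size w -> 0 < i < j ->
  j <= size w ->
  (forall x, 0 < x <= size w -> letter w' x = letter w (exchange i j x)) ->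
  m <= size w ->
  ups w' m + (i <= m < j) * letter w i = ups w m + (i <= m < j) * letter w j.
Proof.
move=> sz ij js lw; elim: m => [|m IHm] ms.
  by rewrite !ups0; have -> : (i <= 0 < j) = false by lia.
have {}IHm := IHm (ltnW ms).
have lm : letter w' m.+1 = letter w (exchange i j m.+1) by apply: lw.
have ms' : m < size w' by rewrite sz.
have S (v : seq bool) : m < size v -> ups v m.+1 = ups v m + letter v m.+1.
  by move=> mv; case l: (letter v m.+1); [rewrite ups_up ?l|rewrite ups_right ?l]; lia.
rewrite !S // lm /exchange.
case: (eqVneq m.+1 i) => [e|ni].
  have [e1 e2] : (i <= m.+1 < j) = true /\ (i <= m < j) = false by lia.
  rewrite e1 e2 in IHm *.
  by rewrite e; lia.
case: (eqVneq m.+1 j) => [e|nj].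
  have [e1 e2] : (i <= m.+1 < j) = false /\ (i <= m < j) = true by lia.
  rewrite e1 e2 in IHm *.
  by rewrite e; lia.
have -> : (i <= m.+1 < j) = (i <= m < j) by lia.
lia.
Qed.

Lemma dyck_of_ups k n (w : (k.+1 * n).-tuple bool) :
  ups w (k.+1 * n) = n ->
  (forall m, m <= k.+1 * n -> rights w m <= k * ups w m) -> is_kdyck k n w.
Proof.
move=> uN le; rewrite /is_kdyck.
have sz : size w = k.+1 * n by rewrite size_tuple.
have : count_mem up w = n by rewrite -{2}uN /ups take_oversize ?sz.
move=> cu; rewrite cu eqxx andTb; apply/andP; split.
  have sz' : size w = n + k * n by rewrite size_tuple mulSn.
  by apply/eqP/(@addnI n); rewrite -sz' -(count_up_right w) cu.
by apply/allP => m; rewrite mem_iota sz ltnS => mN; exact: le.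
Qed.

End Exchange.

(** * Promotion rotates the blocks *)

Section Promotion.
Variables k n : nat.
Notation N := (k.+1 * n).
Hypothesis k0 : 0 < k.
Hypothesis n0 : 0 < n.

Lemma letter_swap (w : N.-tuple bool) i x : 0 < x <= N ->
  letter (swap_letters i w) x = letter w (exchange i i.+1 x).
Proof. by case: x => // x xN; rewrite [LHS]nth_swap_letters. Qed.

(** The exchange moves the path at one point only, and downwards only if it turns
UR into RU; the height there then becomes h(i - 1) - 1. *)
Lemma letter_toggle (p : dyck k n) i x : 0 < i < N -> 0 < x <= N ->
  letter (toggle i p) x =
    if [&& letter p i, ~~ letter p i.+1 & height k p i.-1 == 0] then letter p x
    else letter p (exchange i i.+1 x).
Proof.
move=> iN xN; have szN : size p = N by rewrite size_tuple.
have upsE m : m <= N -> ups (swap_letters i p) m + (m == i) * letter p i =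
    ups p m + (m == i) * letter p i.+1.
  move=> mN; have -> : (m == i) = (i <= m < i.+1) by lia.
  apply: ups_exchange; rewrite ?size_tuple //; try lia.
  by move=> z zN; apply: letter_swap.
have rightsE (w : N.-tuple bool) m : m <= N -> ups w m + rights w m = m.
  by move=> mN; apply: ups_rights; rewrite size_tuple.
have -> : [&& letter p i, ~~ letter p i.+1 & height k p i.-1 == 0] =
          ~~ is_kdyck k n (swap_letters i p).
  apply/idP/negP => [/and3P[li li' /eqP hi] /and3P[_ _ /allP /(_ i)]|nd].
    rewrite mem_iota size_tuple -/(ups _ _) -/(rights _ _) => /(_ ltac:(lia)).
    have := upsE i; have := rightsE (swap_letters i p) i; rewrite eqxx.
    have i1 : i.-1 < N by lia.
    have := height_eq p (ltnW i1); have := rightsE p i.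
    case: (ups_stepP p i1) => -[l eu er]; rewrite prednK in l eu er; try lia.
  apply/negPn/negP => c; apply: nd; apply: dyck_of_ups.
    have := upsE N (leqnn _); have -> : (N == i) = false by lia.
    by rewrite ups_size; lia.
  move=> m mN; have := upsE m mN; have := rightsE (swap_letters i p) m mN.
  have := rightsE p m mN; have := dyck_ge p mN.
  case: (eqVneq m i) => [e|ne]; last first.
    by rewrite !mul0n !addn0 => ? ? ? e; rewrite e; lia.
  subst m; rewrite !mul1n; have i1 : i.-1 < N by lia.
  case li: (letter p i); case li': (letter p i.+1) => ? ? ? e.
  - have -> : ups (swap_letters i p) i = ups p i by lia.
    lia.
  - rewrite li li' /= in c; have := height_eq p (ltnW i1).
    case: (ups_stepP p i1) => -[l eu er]; rewrite prednK in l eu er; try lia.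
  - have -> : ups (swap_letters i p) i = (ups p i).+1 by lia.
    by rewrite mulnS; lia.
  have -> : ups (swap_letters i p) i = ups p i by lia.
  lia.
rewrite /toggle val_insubd.
by case: ifP => d /=; rewrite -?letter_swap // ?letter_swap.
Qed.

(** Under the successive toggles the first up step travels to the right, until the
first point q of height k - 1: it may not pass the right step that ends there and
stays. That right step travels on instead, to the end of the word. *)
Lemma letter_promotion (p : dyck k n) : exists q,
  [/\ 1 < q <= N, ~~ letter p q, (height k p q).+1 = k,
      forall m, 0 < m < q -> k <= height k p m &
      forall x, 0 < x <= N -> letter (promotion_fun p) x =
        (x == q.-1) || ((x != N) && letter p x.+1)].
Proof.
have N1 : 0 < N by rewrite muln_gt0.
have h1 : letter p 1 /\ height k p 1 = k.
  case: (height_stepP p N1) => -[l e]; first by split=> //; rewrite e height0.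
  by rewrite height0 in e.
have ex : exists m, (0 < m <= N) && (height k p m < k).
  by exists N; rewrite N1 leqnn heightN.
case: (ex_minnP ex) => q /andP[qN hq] qmin.
have qm m : 0 < m < q -> k <= height k p m.
  by move=> mq; rewrite leqNgt; apply/negP => c; have := qmin m; rewrite c; lia.
have q1 : 1 < q.
  by case: (ltngtP q 1) => // [|e]; [lia | rewrite e (proj2 h1) ltnn in hq].
have q1N : q.-1 < N by lia.
have [lq eq] : ~~ letter p q /\ (height k p q).+1 = k.
  have := qm q.-1; case: (height_stepP p q1N) => -[l e]; rewrite prednK in l e; try lia.
exists q; split=> //; first lia.
pose P i := foldl (fun p i => toggle i p) p (iota 1 i).
(* After the first i toggles the word is shifted up to position i, the traveller
   is at position i + 1, and the rest is untouched. *)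
suff H i : i < N -> forall x, 0 < x <= N -> letter (P i) x =
    if x <= i then (x == q.-1) || ((x != N) && letter p x.+1)
    else if x == i.+1 then x < q else letter p x.
  move=> x xN; rewrite -[promotion_fun p]/(P N.-1) H //; last lia.
  by case: ifP => // xN1; have e : x = N by [lia]; rewrite e prednK // eqxx /= orbF; lia.
elim: i => [|i IHi] iN x xN.
  have -> : (x <= 0) = false by lia.
  by case: eqP => // ->; rewrite (proj1 h1) q1.
have -> : P i.+1 = toggle i.+1 (P i).
  by rewrite /P -[X in iota 1 X]addn1 iotaD foldl_cat /= add1n.
have {}IHi := IHi (ltnW iN).
have hP m : m <= i -> m < q.-1 -> height k (P i) m + k = height k p m.+1.
  elim: m => [|m IHm] mi mq; first by rewrite height0 (proj2 h1).
  have {}IHm := IHm (ltnW mi) (ltnW mq).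
  have mN : m < N by lia.
  have mN1 : m.+1 < N by lia.
  have e1 : (m.+1 == q.-1) = false by lia.
  have e2 : (m.+1 == N) = false by lia.
  have el := IHi m.+1 ltac:(lia); rewrite mi e1 e2 /= in el.
  case: (height_stepP (P i) mN) => -[l e]; case: (height_stepP p mN1) => -[l' e'];
    rewrite ?l ?l' ?(negPf l) ?(negPf l') // in el; lia.
rewrite letter_toggle; try lia.
have l1 : letter (P i) i.+1 = (i.+1 < q).
  by rewrite IHi; [rewrite ltnn eqxx | lia].
have l2 : letter (P i) i.+2 = letter p i.+2.
  rewrite IHi; last lia.
  have e1 : (i.+2 <= i) = false by lia.
  have e2 : (i.+2 == i.+1) = false by lia.
  by rewrite e1 e2.
rewrite l1 l2 /=.
have iN' : i.+1 < N by lia.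
case: ifPn => [/and3P[iq l /eqP hi]|c].
  have e : q = i.+2.
    have := hP i (leqnn _); rewrite hi add0n.
    have := qm i.+2; have := qm i.+1.
    by case: (height_stepP p iN') => -[l' e']; [rewrite l' in l|]; lia.
  rewrite IHi // e; case: (ltngtP x i.+1) => [c|c|->]; rewrite ?eqxx //=.
  - by have -> : x <= i by lia.
  - have -> : (x <= i) = false by lia.
    by case: eqP => // ->; rewrite ltnn; apply: negbTE.
  by rewrite ltnn ltnSn.
rewrite /exchange; case: (eqVneq x i.+1) => [->|n1].
  rewrite l2 leqnn; have -> : i.+1 != N by lia.
  case: (eqVneq i.+1 q.-1) => [e|ne]; last by [].
  have eq2 : i.+2 = q by lia.
  have := hP i (leqnn _) ltac:(lia); have := height_stepP p iN'; rewrite eq2.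
  case=> -[l e']; first by rewrite l in lq.
  by move=> hi; case/negP: c; rewrite eq2 lq; lia.
case: (eqVneq x i.+2) => [->|n2].
  rewrite l1 ltnn; have -> : (i.+1 < q) = (i.+2 < q); last by [].
  case: (ltngtP i.+2 q) => [|//|e]; try lia.
  have := hP i (leqnn _) ltac:(lia); have := height_stepP p iN'; rewrite e.
  case=> -[l e']; first by rewrite l in lq.
  by move=> hi; case/negP: c; rewrite e lq; lia.
rewrite IHi //; case: (ltngtP x i.+1) => [c'|c'|e].
- by have -> : x <= i by lia.
- by have -> : (x <= i) = false by lia.
by rewrite e eqxx in n1.
Qed.

(** Rotation of the positions by one step to the left. *)
Definition turn (x : nat) : nat := if x == 1 then N else x.-1.

(** Before q - 1 all heights drop by k, after it they grow by one, so the shape of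
the path on either side is preserved and only the block of the first up step is
cut open: its remaining steps and the new last step N now belong to q - 1. *)
Lemma partner_promotion (p : dyck k n) x y : 0 < x <= N -> 0 < y <= N ->
  (partner (promotion_fun p) (turn x) == partner (promotion_fun p) (turn y)) =
  (partner p x == partner p y).
Proof.
have N1 : 0 < N by rewrite muln_gt0.
have [q [qN lq hq qm lE]] := letter_promotion p; set p' := promotion_fun p.
(* New position of the up step of the rotated block. *)
pose g u := if u == 1 then q.-1 else u.-1.
have h1 : letter p 1 /\ height k p 1 = k.
  case: (height_stepP p N1) => -[l e]; first by split=> //; rewrite e height0.
  by rewrite height0 in e.
have hlo m : m < q.-1 -> height k p' m + k = height k p m.+1.
  elim: m => [|m IHm] mq; first by rewrite height0 (proj2 h1).
  have {}IHm := IHm (ltnW mq).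
  have mN : m < N by lia.
  have mN1 : m.+1 < N by lia.
  have e1 : (m.+1 == q.-1) = false by lia.
  have e2 : (m.+1 == N) = false by lia.
  have el := lE m.+1 ltac:(lia); rewrite e1 e2 /= in el.
  case: (height_stepP p' mN) => -[l e]; case: (height_stepP p mN1) => -[l' e'];
    rewrite ?l ?l' ?(negPf l) ?(negPf l') // in el; lia.
have hhi m : q.-1 <= m < N -> height k p' m = (height k p m.+1).+1.
  elim: m => [|m IHm] mq; first lia.
  have mN : m < N by lia.
  have mN1 : m.+1 < N by lia.
  have e2 : (m.+1 == N) = false by lia.
  have el := lE m.+1 ltac:(lia); rewrite e2 /= in el.
  case: (ltngtP m.+1 q.-1) => c; first lia.
    have {}IHm := IHm ltac:(lia); rewrite gtn_eqF //= in el.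
    case: (height_stepP p' mN) => -[l e]; case: (height_stepP p mN1) => -[l' e'];
      rewrite ?l ?l' ?(negPf l) ?(negPf l') // in el; lia.
  have hm := hlo m ltac:(lia); rewrite c eqxx in el.
  have e3 : m.+2 = q by lia.
  have hq1 := qm m.+1 ltac:(lia).
  case: (height_stepP p' mN) => -[l e]; last by rewrite c el in l.
  case: (height_stepP p mN1) => -[l' e']; last by lia.
  by rewrite e3 (negPf lq) in l'.
have H z : 0 < z <= N -> partner p' (turn z) = g (partner p z).
  move=> zN; have [pz hp hpm] := partnerP p zN.
  rewrite /turn /g; case: (eqVneq z 1) => [e|z1].
    subst z; rewrite (partner_up zN (proj1 h1)) eqxx.
    apply: partner_uniq; rewrite ?heightN ?leqn0; try lia.
      have := hlo q.-2 ltac:(lia); have := height_stepP p (m := q.-1) ltac:(lia).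
      have -> : q.-1.+1 = q by lia.
      have -> : q.-2.+1 = q.-1 by lia.
      by rewrite (negPf lq); case=> -[// _]; lia.
    by move=> m mq; rewrite hhi; lia.
  case: (eqVneq z q) => [e|zq].
    subst z; have -> : partner p q = 1.
      apply: partner_uniq => //=; try lia; first by rewrite height0.
      by move=> m mq; have := qm m; lia.
    rewrite eqxx partner_up //; first lia.
    by rewrite lE ?eqxx //; lia.
  case: (eqVneq (partner p z) 1) => [e|p1].
    rewrite e in pz hp hpm.
    have qz : q < z.
      rewrite ltnNge; apply/negP => zq'; have := qm z ltac:(lia).
      by have := hpm 1; rewrite (proj2 h1); lia.
    apply: partner_uniq; try lia.
      rewrite (hhi z.-1); last lia.
      have := hlo q.-2 ltac:(lia); have := height_stepP p (m := q.-1) ltac:(lia).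
      have -> : q.-1.+1 = q by lia.
      have -> : q.-2.+1 = q.-1 by lia.
      by rewrite (negPf lq); case=> -[// _]; lia.
    move=> m mq; rewrite !hhi; try lia.
    by rewrite ltnS prednK; [apply: hpm; lia | lia].
  have pzN : 0 < partner p z <= N by lia.
  case: (ltnP z q) => zq'.
    apply: partner_uniq; try lia.
      have := hlo z.-1 ltac:(lia); have := hlo (partner p z).-2 ltac:(lia).
      by rewrite !prednK; lia.
    move=> m mq; have := hlo m ltac:(lia); have := hlo z.-1 ltac:(lia).
    rewrite prednK; last lia.
    by have := hpm m.+1; lia.
  have pq : q < partner p z.
    rewrite ltnNge; apply/negP => pq.
    have := hpm q; have := qm (partner p z).-1 ltac:(lia); lia.
  apply: partner_uniq; try lia.
    by rewrite !hhi ?prednK; lia.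
  move=> m mq; rewrite !hhi ?prednK; try lia.
  by have := hpm m.+1; lia.
move=> xN yN; rewrite !H //.
have [px _ _] := partnerP p xN; have [py _ _] := partnerP p yN.
have nq z : 0 < z <= N -> partner p z <> q.
  by move=> zN e; have := partner_letter p zN; rewrite e (negPf lq).
have := nq x xN; have := nq y yN; rewrite /g.
case: (eqVneq (partner p x) 1) => ex; case: (eqVneq (partner p y) 1) => ey; lia.
Qed.

End Promotion.


(** * Boxes, diagonals and layers *)

Section UpPositions.
Variables k n : nat.
Notation N := (k.+1 * n).
Variable p : dyck k n.

Lemma up_positions_split u : 0 < u <= N -> letter p u ->
  up_positions p = [seq x <- iota 1 u.-1 | letter p x] ++
                   u :: [seq x <- iota u.+1 (N - u) | letter p x].
Proof.
move=> uN lu; rewrite /up_positions size_dyck.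
have -> : iota 1 N = iota 1 u.-1 ++ iota u 1 ++ iota u.+1 (N - u).
  have {1}-> : N = u.-1 + (1 + (N - u)) by lia.
  by rewrite !iotaD; do ![congr (_ ++ _)]; congr iota; lia.
rewrite !filter_cat /= lu /=.
by congr (_ ++ _ :: _); apply: eq_filter => x; case: (letter p x).
Qed.

Lemma nth_up_positions u : 0 < u <= N -> letter p u ->
  nth 0 (up_positions p) (ups p u.-1) = u.
Proof.
move=> uN lu; rewrite (up_positions_split uN lu) ups_count; last by rewrite size_dyck; lia.
by rewrite -size_filter nth_cat ltnn subnn.
Qed.

Lemma size_up_positions : size (up_positions p) = n.
Proof.
rewrite size_filter size_dyck; apply: etrans (ups_size p); rewrite ups_count ?size_dyck //.
by apply: eq_count => x; case: (letter p x).
Qed.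

Lemma nth_up_positionsP y : y < n ->
  let u := nth 0 (up_positions p) y in
  [/\ 0 < u <= N, letter p u, ups p u.-1 = y & ups p u = y.+1].
Proof.
move=> yn u.
have : u \in up_positions p by rewrite mem_nth // size_up_positions.
rewrite mem_up_positions => /andP[uN lu].
have u1N : u.-1 < N by lia.
have e : ups p u.-1 = y.
  apply/eqP; rewrite -(nth_uniq 0 (s := up_positions p)) ?nth_up_positions //.
  - rewrite size_up_positions; have := ups_le p (m := u) ltac:(lia).
    by case: (ups_stepP p u1N) => -[l ee _]; rewrite prednK in l ee; lia.
  - by rewrite size_up_positions.
  by rewrite filter_uniq ?iota_uniq.
split=> //; case: (ups_stepP p u1N) => -[l ee _]; rewrite prednK in l ee; try lia.
Qed.

End UpPositions.

Section Region.
Variables k n : nat.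
Notation N := (k.+1 * n).
Implicit Types (p : dyck k n) (b : box k n).

(** A path through the south-east corner of b has it as its point number
[index_of b]. *)
Definition index_of b : nat := (b.1 + b.2).+1.

Lemma rights_eq p m : m <= N -> ups p m + rights p m = m.
Proof. by move=> mN; apply: ups_rights; rewrite size_dyck. Qed.

Lemma index_lt b : 0 < index_of b < N.
Proof.
rewrite /index_of; have := ltn_ord b.1; have := ltn_ord b.2.
by rewrite mulSn; lia.
Qed.

Lemma in_region p b : (b \in region_above p) = (ups p (index_of b) <= b.2).
Proof.
rewrite inE /row_length -/(rights p _); have bN := index_lt b.
have [uN lu e1 e2] := nth_up_positionsP p (ltn_ord b.2).
set u := nth _ _ _ in uN lu e1 e2 *.
have := rights_eq p (m := u.-1) ltac:(lia); rewrite e1.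
have := @leq_ups p (index_of b) u.-1; have := @leq_ups p u (index_of b).
rewrite /index_of in bN *; lia.
Qed.

Lemma box_at m y : 0 < m -> y < n -> y < m <= k * n + y ->
  exists b, index_of b = m /\ nat_of_ord b.2 = y.
Proof.
move=> m0 yn ym; have xk : m.-1 - y < k * n by lia.
by exists (Ordinal xk, Ordinal yn); rewrite /index_of /=; split=> //; lia.
Qed.

Lemma southeastP b b' : southeast b b' -> index_of b' = index_of b /\ (nat_of_ord b'.2).+1 = nat_of_ord b.2.
Proof. by rewrite /southeast /index_of /= => /andP[/eqP e1 /eqP e2]; lia. Qed.

Lemma southeast_at b b' : index_of b' = index_of b -> (nat_of_ord b'.2).+1 = nat_of_ord b.2 -> southeast b b'.
Proof. by rewrite /southeast /index_of /= => e1 e2; apply/andP; split; lia. Qed.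

Lemma mem_scanl_move (c : seq bool) (a x : nat * nat) :
  reflect (exists2 i, i <= size c & x = (a.1 + rights c i, a.2 + ups c i))
          (x \in a :: scanl move a c).
Proof.
elim: c a x => [|s c IHc] a x /=.
  rewrite inE; apply: (iffP eqP) => [->|[i]].
    by exists 0; rewrite // rights0 ups0 !addn0; case: a.
  by rewrite leqn0 => /eqP -> ->; rewrite rights0 ups0 !addn0; case: a.
rewrite inE; apply: (iffP orP) => [[/eqP->|/IHc [i ic ->]]|[[|i] ic ->]].
- by exists 0; rewrite // rights0 ups0 !addn0; case: a.
- exists i.+1; rewrite // /ups /rights /move /=.
  by case: s => /=; congr (_, _); lia.
- by left; rewrite rights0 ups0 !addn0; case: a.
right; apply/IHc; exists i => //.
by rewrite /ups /rights /move /=; case: s => /=; congr (_, _); lia.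
Qed.

End Region.

Section Tiling.
Variables k n : nat.
Notation N := (k.+1 * n).
Variable P : dyck k n.
Notation h := (height k P).
Notation region := (region_above P).
Implicit Types (b : box k n) (d : {set box k n}) (D : {set {set box k n}}).

Definition balancedb (s t : nat) : bool :=
  [&& s <= t, t <= N, h t == h s & all (fun m => h s <= h m) (iota s (t - s).+1)].

Lemma balancedP s t : reflect (balanced P s t) (balancedb s t).
Proof.
apply: (iffP and4P) => [[st tN /eqP e /allP a]|[stN e a]].
  by split; rewrite ?st // => m m_st; apply: a; rewrite mem_iota; lia.
split; try lia.
by apply/allP => m; rewrite mem_iota => m_st; apply: a; lia.
Qed.

(** The points s, ..., t of P, translated by (-j, j), are south-east corners of
boxes of the rectangle. *)
Definition tile_points (j s t : nat) : bool :=
  [&& balancedb s t, j < rights P s & ups P t + j < n].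

(** Some k-Dyck tile of layer j covers the diagonals m and m'. *)
Definition joined (j m m' : nat) : bool :=
  [exists s : 'I_N.+1, exists t : 'I_N.+1,
    [&& s <= m, s <= m', m <= t, m' <= t & tile_points j s t]].

Lemma joinedP j m m' : reflect
  (exists s t, [/\ s <= m <= t, s <= m' <= t, balanced P s t & j < rights P s /\ ups P t + j < n])
  (joined j m m').
Proof.
apply: (iffP existsP) => [[s /existsP[t /and5P[? ? ? ? /and3P[/balancedP b js tn]]]]|].
  by exists s, t; split=> //; lia.
case=> s [t [ms ms' b [js tn]]]; have [stN _ _] := b.
have sN : s < N.+1 by lia.
have tN : t < N.+1 by lia.
exists (Ordinal sN); apply/existsP; exists (Ordinal tN) => /=.
have /balancedP bb := b.
by rewrite /tile_points bb js tn; lia.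
Qed.

Lemma balanced_refl m : m <= N -> balanced P m m.
Proof. by move=> mN; split=> //; [lia | move=> m' mm; have -> : m' = m by lia]. Qed.

(** At a common point both factors are at least as high as their ends. If none
contains the other, the end of each is thus at least as high as the other one. *)
Lemma balanced_union s1 t1 s2 t2 m : balanced P s1 t1 -> balanced P s2 t2 ->
  s1 <= m <= t1 -> s2 <= m <= t2 -> balanced P (minn s1 s2) (maxn t1 t2).
Proof.
wlog s12 : s1 t1 s2 t2 / s1 <= s2 => [H b1 b2 m1 m2|].
  case/orP: (leq_total s1 s2) => c; first exact: H.
  by rewrite minnC maxnC; apply: H.
move=> b1 b2 m1 m2; have [e1 e2 e3] := b1; have [f1 f2 f3] := b2.
rewrite (minn_idPl s12); case/orP: (leq_total t2 t1) => c; first by rewrite (maxn_idPl c).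
rewrite (maxn_idPr c).
have hs2 := e3 s2 ltac:(lia); have ht1 := f3 t1 ltac:(lia).
have es : h s1 = h s2 by lia.
split; [lia | lia | move=> x xs].
by case: (leqP x t1) => c'; [apply: e3 | rewrite es; apply: f3]; lia.
Qed.

Lemma joined_sym j m m' : joined j m m' = joined j m' m.
Proof. by apply/joinedP/joinedP => -[s [t [? ? ? ?]]]; exists s, t. Qed.

Lemma joined_trans j m1 m2 m3 : joined j m1 m2 -> joined j m2 m3 -> joined j m1 m3.
Proof.
move=> /joinedP[s1 [t1 [a1 a2 a3 [a4 a5]]]] /joinedP[s2 [t2 [b1 b2 b3 [b4 b5]]]].
apply/joinedP; exists (minn s1 s2), (maxn t1 t2); split; try lia.
  exact: balanced_union a2 b1.
by split; [rewrite /minn | rewrite /maxn]; case: ifP.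
Qed.

Lemma joined_refl j m : m <= N -> j < rights P m -> ups P m + j < n -> joined j m m.
Proof.
move=> mN jm mn; apply/joinedP; exists m, m; split; rewrite ?leqnn //.
exact: balanced_refl.
Qed.

Lemma joined_layer j j' m m' : j' <= j -> joined j m m' -> joined j' m m'.
Proof.
move=> jj /joinedP[s [t [? ? ? [? ?]]]]; apply/joinedP; exists s, t; split=> //; lia.
Qed.

Lemma joined_valid j m m' : joined j m m' ->
  [/\ 0 < m < N, j < rights P m & ups P m + j < n].
Proof.
move=> /joinedP[s [t [ms _ [stN _ _] [js tn]]]].
have := leq_rights P (m1 := s) (m2 := m) ltac:(lia).
have := leq_ups P (m1 := m) (m2 := t) ltac:(lia).
have r0 : rights P 0 = 0 by apply: rights0.
have uN : ups P N = n by apply: ups_size.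
have := rights_eq P (m := m) ltac:(lia).
by case: (eqVneq m N) => [->|?]; rewrite ?uN; split; lia.
Qed.

Definition layer b : nat := b.2 - ups P (index_of b).

Lemma layer_eq b : b \in region -> nat_of_ord b.2 = ups P (index_of b) + layer b.
Proof. by rewrite in_region /layer => ?; rewrite subnKC. Qed.

Lemma region_valid b : b \in region ->
  layer b < rights P (index_of b) /\ ups P (index_of b) + layer b < n.
Proof.
move=> br; have bN := index_lt b; have := layer_eq br; have := ltn_ord b.2.
have := rights_eq P (m := index_of b) ltac:(lia).
have : index_of b = (b.1 + b.2).+1 by [].
by move=> *; split; lia.
Qed.

Lemma box_in j m : m <= N -> j < rights P m -> ups P m + j < n ->
  exists b, [/\ b \in region, index_of b = m, layer b = j & nat_of_ord b.2 = ups P m + j].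
Proof.
move=> mN jm mn; have e := rights_eq P mN; have := rights_le P mN => rk.
have [||| b [ib yb]] := @box_at k n m (ups P m + j); try lia.
exists b; rewrite in_region /layer ib yb; split=> //; lia.
Qed.

(** * The maximal cover-inclusive tiling *)

Definition same_tile b b' : bool :=
  (layer b == layer b') && joined (layer b) (index_of b) (index_of b').

Definition Dmax : {set {set box k n}} := equivalence_partition same_tile region.

Lemma same_tile_equiv : {in region & &, equivalence_rel same_tile}.
Proof.
move=> x y z xr yr zr; rewrite /same_tile; split.
  have [r1 r2] := region_valid zr; have zN := index_lt z.
  by rewrite eqxx joined_refl // ltnW //; case/andP: zN.
move=> /andP[/eqP e jxy]; rewrite -e.
case: eqP => //= _; apply/idP/idP; last exact: joined_trans.
by apply: joined_trans; rewrite joined_sym.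
Qed.

Lemma Dmax_partition : partition Dmax region.
Proof. exact: equivalence_partitionP same_tile_equiv. Qed.

Definition tile_set (j s t : nat) : {set box k n} :=
  [set b | (s <= index_of b <= t) && (nat_of_ord b.2 == ups P (index_of b) + j)].

Definition max_tile (j s t : nat) : Prop :=
  [/\ balanced P s t, j < rights P s /\ ups P t + j < n &
      forall m, joined j s m -> s <= m <= t].

Lemma max_tile_joined j s t m m' : max_tile j s t ->
  s <= m <= t -> s <= m' <= t -> joined j m m'.
Proof. by case=> b w _ ms ms'; apply/joinedP; exists s, t. Qed.

Lemma max_tile_closed j s t m m' : max_tile j s t ->
  s <= m <= t -> joined j m m' -> s <= m' <= t.
Proof.
move=> T ms jm; have [[st _ _] _ H] := T; apply: H.
by apply: joined_trans jm; apply: max_tile_joined T _ _; lia.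
Qed.

Lemma max_tile_valid j s t m : max_tile j s t -> s <= m <= t ->
  [/\ 0 < m < N, j < rights P m & ups P m + j < n].
Proof. by move=> T ms; have /joined_valid := max_tile_joined T ms ms. Qed.

(** The points joined to m form the wanted interval: its two ends are joined, and
the balanced factor that joins them consists of points joined to m. *)
Lemma max_tile_exists j m : m <= N -> j < rights P m -> ups P m + j < n ->
  exists s t, max_tile j s t /\ s <= m <= t.
Proof.
move=> mN jm mn; have mm := joined_refl mN jm mn.
have ex : exists m', joined j m m' by exists m.
have ub m' : joined j m m' -> m' <= N.
  by rewrite joined_sym => /joined_valid[]; lia.
case: (ex_minnP ex) => s js smin; case: (ex_maxnP ex ub) => t jt tmax.
have sm := smin m mm; have mt := tmax m mm.
have jst : joined j s t by apply: joined_trans jt; rewrite joined_sym.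
case/joinedP: (jst) => s' [t' [a1 a2 b w]].
have js' : joined j m s'.
  by apply: (joined_trans js); apply/joinedP; exists s', t'; split=> //; lia.
have jt' : joined j m t'.
  by apply: (joined_trans js); apply/joinedP; exists s', t'; split=> //; lia.
have es : s' = s by have := smin _ js'; lia.
have et : t' = t by have := tmax _ jt'; lia.
subst s' t'; exists s, t; split; last lia.
split=> // m' jsm; have jm' := joined_trans js jsm.
by have := smin _ jm'; have := tmax _ jm'; lia.
Qed.

Lemma tile_setP j s t b : max_tile j s t -> b \in tile_set j s t ->
  [/\ b \in region, s <= index_of b <= t, layer b = j & nat_of_ord b.2 = ups P (index_of b) + j].
Proof.
move=> T; rewrite inE => /andP[ist /eqP e]; split=> //.
  by rewrite in_region e leq_addr.
by rewrite /layer e addKn.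
Qed.

Lemma mem_tile_set j s t b : b \in region -> s <= index_of b <= t -> layer b = j ->
  b \in tile_set j s t.
Proof. by move=> br ist <-; rewrite inE ist; apply/eqP; apply: layer_eq. Qed.

Lemma tile_box j s t m : max_tile j s t -> s <= m <= t ->
  exists2 b, b \in tile_set j s t & index_of b = m /\ nat_of_ord b.2 = ups P m + j.
Proof.
move=> T ms; have [mN jm mn] := max_tile_valid T ms.
have [|b [br ib lb yb]] := @box_in j m _ jm mn; first lia.
by exists b => //; apply: mem_tile_set; rewrite ?ib.
Qed.

Lemma class_tile_set j s t b : max_tile j s t -> b \in tile_set j s t ->
  [set b' in region | same_tile b b'] = tile_set j s t.
Proof.
move=> T bt; have [br ib lb yb] := tile_setP T bt.
apply/setP => b'; rewrite inE /same_tile lb; apply/and3P/idP => [[br' /eqP lb' jb]|bt'].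
  by apply: mem_tile_set => //; apply: max_tile_closed jb.
have [br' ib' lb' yb'] := tile_setP T bt'.
by rewrite lb'; split=> //; apply: max_tile_joined T _ _.
Qed.

Lemma DmaxP d : reflect (exists j s t, max_tile j s t /\ d = tile_set j s t) (d \in Dmax).
Proof.
apply: (iffP imsetP) => [[b br ->]|[j [s [t [T ->]]]]].
  have [jb bn] := region_valid br; have bN := index_lt b.
  have [|s [t [T ib]]] := max_tile_exists _ jb bn; first lia.
  exists (layer b), s, t; split=> //; apply: class_tile_set => //.
  exact: mem_tile_set.
have [[st _ _] _ _] := T; have [|b bt [ib yb]] := @tile_box _ _ _ s T; first lia.
by exists b; [case: (tile_setP T bt) | rewrite (class_tile_set T bt)].
Qed.

Lemma ups_factor s t i : i <= t - s -> t <= N ->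
  ups (take (t - s) (drop s P)) i = ups P (s + i) - ups P s /\
  rights (take (t - s) (drop s P)) i = rights P (s + i) - rights P s.
Proof.
move=> it tN; rewrite /ups /rights -take_min (minn_idPl it) takeD !count_cat.
by split; rewrite addKn.
Qed.

Lemma tile_set_is_tile j s t : max_tile j s t -> is_tile (tile_set j s t).
Proof.
move=> T; have [[stN hst hm] [js tn] _] := T.
set c := take (t - s) (drop s P).
have sc : size c = t - s by rewrite size_takel // size_drop size_dyck; lia.
have [|b0 b0t [ib0 yb0]] := @tile_box _ _ _ s T; first lia.
have uc i : i <= t - s -> ups P (s + i) = ups P s + ups c i /\
                          rights P (s + i) = rights P s + rights c i.
  move=> it; have [-> ->] := @ups_factor s t i it ltac:(lia).
  by rewrite !subnKC ?leq_ups ?leq_rights ?leq_addr.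
have kc i : i <= t - s -> height k P s + k * ups c i = height k P (s + i) + rights c i.
  move=> it; have [e1 e2] := uc i it; have := height_eq P (m := s + i) ltac:(lia).
  by have := height_eq P (m := s) ltac:(lia); rewrite e1 e2 mulnDr; lia.
have upt : count_mem up c = ups c (t - s) by rewrite /ups -sc take_size.
have rct : count_mem right c = rights c (t - s) by rewrite /rights -sc take_size.
exists (ups c (t - s)), c, (corner b0); split.
  rewrite /is_kdyck upt rct eqxx andTb; apply/andP; split.
    by have := kc (t - s) (leqnn _); rewrite subnKC ?hst; lia.
  apply/allP => i; rewrite mem_iota sc -/(rights c i) -/(ups c i) => it.
  by have := kc i ltac:(lia); have := hm (s + i) ltac:(lia); lia.
move=> x; apply/imageP/mem_scanl_move => [[b bt ->]|[i]].
  have [br ib lb yb] := tile_setP T bt; exists (index_of b - s); first lia.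
  have [e1 e2] := uc (index_of b - s) ltac:(lia).
  rewrite subnKC in e1 e2; last lia.
  have := rights_eq P (m := index_of b) ltac:(lia); have := rights_eq P (m := s) ltac:(lia).
  have : index_of b = (b.1 + b.2).+1 by [].
  have : index_of b0 = (b0.1 + b0.2).+1 by [].
  move=> i0 i1 rs rb.
  have E1 : nat_of_ord b.1 = b0.1 + rights c (index_of b - s) by lia.
  have E2 : nat_of_ord b.2 = b0.2 + ups c (index_of b - s) by lia.
  by rewrite /corner /= E1 E2.
rewrite sc => it ->; have [|b bt [ib yb]] := @tile_box _ _ _ (s + i) T; first lia.
exists b => //; have [e1 e2] := uc i it.
have := rights_eq P (m := s + i) ltac:(lia); have := rights_eq P (m := s) ltac:(lia).
have : index_of b = (b.1 + b.2).+1 by [].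
have : index_of b0 = (b0.1 + b0.2).+1 by [].
move=> i0 i1 rs rb.
have E1 : nat_of_ord b.1 = b0.1 + rights c i by lia.
have E2 : nat_of_ord b.2 = b0.2 + ups c i by lia.
by rewrite /corner /= E1 E2.
Qed.

Lemma Dmax_tiling : is_tiling P Dmax.
Proof.
split; first exact: Dmax_partition.
by move=> d /DmaxP[j [s [t [T ->]]]]; apply: tile_set_is_tile.
Qed.

Lemma Dmax_cover_inclusive : cover_inclusive P Dmax.
Proof.
move=> d /DmaxP[[|j] [s [t [T ->]]]].
  left=> b b' bt se; have [br ib lb yb] := tile_setP T bt.
  by have [e1 e2] := southeastP se; rewrite in_region e1; lia.
right; have [[st _ _] _ _] := T.
have [sN js sn] := max_tile_valid T (m := s) ltac:(lia).
have [|||s' [t' [T' st']]] := @max_tile_exists j s; try lia.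
exists (tile_set j s' t'); first by apply/DmaxP; exists j, s', t'.
move=> b bt; have [br ib lb yb] := tile_setP T bt.
have ib' : s' <= index_of b <= t'.
  apply: (max_tile_closed T' st'); apply: (@joined_layer j.+1) => //.
  by apply: (max_tile_joined T); lia.
have [b' bt' [ib2 yb2]] := tile_box T' ib'.
by exists b' => //; apply: southeast_at; lia.
Qed.

(** A tile translated by (1, -1) again and again stays in tiles until all of it
leaves the region at once; the number of translations is the layer. *)
Lemma layer_constant D : is_tiling P D -> cover_inclusive P D ->
  forall d, d \in D -> {in d &, forall b b', layer b = layer b'}.
Proof.
move=> [partD tD] ciD d.
have subD d' b : d' \in D -> b \in d' -> b \in region.
  by move=> dD bd; rewrite -(cover_partition partD); apply/bigcupP; exists d'.
suff H L : forall d, d \in D -> (exists2 b, b \in d & layer b <= L) ->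
    {in d &, forall b b', layer b = layer b'}.
  by move=> dD b b' bd bd'; apply: (H (layer b) d) => //; exists b.
elim/ltn_ind: L => L IH d' dD [b0 b0d lb0] b b' bd bd'.
case: (ciD d' dD) => [out|[d2 d2D se]].
  suff l0 x : x \in d' -> layer x = 0 by rewrite !l0.
  move=> xd; apply/eqP; rewrite -leqn0 leqNgt; apply/negP => lx.
  have xr := subD _ _ dD xd; have yx := layer_eq xr.
  have [rx ux] := region_valid xr; have xN := index_lt x.
  have [|||x' [xr' ix' lx' yx']] := @box_in (layer x).-1 (index_of x); try lia.
  by have := out x x' xd (southeast_at ix' ltac:(lia)); rewrite xr'.
have lay x : x \in d' -> exists2 x', x' \in d2 & layer x = (layer x').+1.
  move=> xd; have [x' xd' /southeastP[e1 e2]] := se x xd; exists x' => //.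
  have := layer_eq (subD _ _ dD xd); have := layer_eq (subD _ _ d2D xd').
  by rewrite e1; lia.
have [b1 b1d e1] := lay b bd; have [b1' b1d' e1'] := lay b' bd'.
have [b2 b2d e2] := lay b0 b0d; rewrite e1 e1'.
by congr _.+1; apply: (IH (layer b2) _ d2) => //; [lia | exists b2].
Qed.

(** On one layer a tile follows the steps of P, so it joins its boxes. *)
Lemma tiling_refines D : is_tiling P D -> cover_inclusive P D ->
  forall d, d \in D -> exists2 d', d' \in Dmax & d \subset d'.
Proof.
move=> tiD ciD d dD; have [partD tD] := tiD.
have subD b : b \in d -> b \in region.
  by move=> bd; rewrite -(cover_partition partD); apply/bigcupP; exists d.
have lc := layer_constant tiD ciD dD.
have [m [c [a [kc dE]]]] := tD d dD.
have pt i : i <= size c -> exists2 b, b \in d &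
    nat_of_ord b.1 = a.1 + rights c i /\ nat_of_ord b.2 = a.2 + ups c i.
  move=> ic; have : (a.1 + rights c i, a.2 + ups c i) \in [seq corner b | b in d].
    by rewrite dE; apply/mem_scanl_move; exists i.
  by case/imageP => b bd [/= e1 e2]; exists b.
have [b0 b0d [x0 y0]] := pt 0 (leq0n _).
rewrite rights0 addn0 in x0; rewrite ups0 addn0 in y0.
set s := index_of b0; set L := layer b0.
have szc : size c = ups c (size c) + rights c (size c) by rewrite ups_rights.
have up_at i : i <= size c -> s + i < N /\ ups P (s + i) = ups P s + ups c i.
  move=> ic; have [b bd [x y]] := pt i ic.
  have y0' : nat_of_ord b0.2 = ups P s + L := layer_eq (subD _ b0d).
  have ib : index_of b = s + i.
    by rewrite /s /index_of; have := ups_rights ic; lia.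
  have yb := layer_eq (subD _ bd); rewrite (lc _ _ bd b0d) -/L ib in yb.
  by have := index_lt b; rewrite ib; split; lia.
have rt_at i : i <= size c -> rights P (s + i) = rights P s + rights c i.
  move=> ic; have [iN e] := up_at i ic.
  have := rights_eq P (m := s + i) ltac:(lia); have := rights_eq P (m := s) ltac:(lia).
  by have := ups_rights ic; lia.
have h_at i : i <= size c -> h s + k * ups c i = h (s + i) + rights c i.
  move=> ic; have [iN e] := up_at i ic; have e' := rt_at i ic.
  have := height_eq P (m := s + i) ltac:(lia); have := height_eq P (m := s) ltac:(lia).
  by rewrite e e' mulnDr; lia.
case/and3P: kc => /eqP cu /eqP cr /allP ck.
have bal : balanced P s (s + size c).
  have [scN _] := up_at _ (leqnn _).
  split; first lia.
    have := h_at _ (leqnn _); rewrite /ups /rights take_size cu cr; lia.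
  move=> m' ms; have := h_at (m' - s) ltac:(lia); rewrite subnKC; last lia.
  have := ck (m' - s); rewrite mem_iota -/(rights c _) -/(ups c _) => /(_ ltac:(lia)); lia.
have [js0 sn0] := region_valid (subD _ b0d).
have tn : ups P (s + size c) + L < n.
  have [b bd [x y]] := pt _ (leqnn (size c)); have [_ e] := up_at _ (leqnn (size c)).
  have y0' : nat_of_ord b0.2 = ups P s + L := layer_eq (subD _ b0d).
  by have := ltn_ord b.2; lia.
exists [set b' in region | same_tile b0 b'].
  by apply/imsetP; exists b0 => //; apply: subD.
apply/subsetP => b bd; rewrite inE subD //= /same_tile (lc _ _ b0d bd) eqxx /=.
rewrite -(lc _ _ b0d bd); apply/joinedP; exists s, (s + size c); split=> //; first lia.
have : corner b \in a :: scanl move a c by rewrite -dE; apply/imageP; exists b.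
case/mem_scanl_move => i ic [x y].
have x1 : nat_of_ord b.1 = a.1 + rights c i := x.
have y1 : nat_of_ord b.2 = a.2 + ups c i := y.
have -> : index_of b = s + i.
  by rewrite /s /index_of; have := ups_rights ic; lia.
lia.
Qed.

Lemma Dmax_maximal : maximal_cover_inclusive P Dmax.
Proof.
split; [exact: Dmax_tiling | exact: Dmax_cover_inclusive |].
case=> D [nD tiD ciD sub]; case/negP: nD; apply/eqP.
have sDM d : d \in Dmax -> d \in D.
  move=> dM; have [d1 d1D s1] := sub d dM; have [d2 d2M s2] := tiling_refines tiD ciD d1D.
  suff e : d = d2.
    by have -> : d = d1 by apply/eqP; rewrite eqEsubset s1 e.
  have d0 : d != set0 by apply: contraTneq dM => ->; case/and3P: Dmax_partition.
  case/set0Pn: d0 => b bd.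
  have /trivIsetP tr : trivIset Dmax by case/and3P: Dmax_partition.
  apply/eqP/negPn/negP => ne; have /pred0P/(_ b) := tr d d2 dM d2M ne.
  by rewrite /= bd (subsetP s2) // (subsetP s1).
apply/setP => d; apply/idP/idP; last exact: sDM.
move=> dD; have [d2 d2M s2] := tiling_refines tiD ciD dD.
have [partD _] := tiD; case/and3P: partD => _ /trivIsetP tr n0.
have d0 : d != set0 by apply: contraTneq dD => ->.
case/set0Pn: d0 => b bd.
suff -> : d = d2 by [].
apply/eqP/negPn/negP => ne; have /pred0P/(_ b) := tr d d2 dD (sDM _ d2M) ne.
by rewrite /= bd (subsetP s2).
Qed.

Lemma maximal_unique D : maximal_cover_inclusive P D -> D = Dmax.
Proof.
case=> tiD ciD mD; apply/eqP/negPn/negP => ne; case: mD; exists Dmax.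
split; [by rewrite eq_sym | exact: Dmax_tiling | exact: Dmax_cover_inclusive |].
exact: tiling_refines.
Qed.

End Tiling.


(** * Adding tiles *)

Section AddTile.
Variables k n : nat.
Notation N := (k.+1 * n).
Variable P : dyck k n.
Notation h := (height k P).
Implicit Types (p : dyck k n) (b : box k n) (d : {set box k n}).

Lemma path_box p m : m <= N -> ups p m < n -> ups p m < m ->
  exists b, index_of b = m /\ nat_of_ord b.2 = ups p m.
Proof.
move=> mN un um; have := rights_le p mN; have := rights_eq p mN => *.
by apply: box_at; lia.
Qed.

(** On each diagonal the boxes above a path are all those from some height on, so
the box removed from it must be the lowest one. *)
Lemma add_tile_ups p p' j s t : max_tile P j s t -> add_tile p (tile_set P j s t) p' ->
  (forall m, s <= m <= t -> ups p m = ups P m + j) /\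
  (forall m, m <= N -> ups p' m = ups p m + (s <= m <= t)).
Proof.
move=> T [sub reg].
have inp' b : b \in region_above p' = (b \notin tile_set P j s t) && (b \in region_above p).
  by rewrite reg inE.
have on m : s <= m <= t -> ups p m = ups P m + j /\ ups p' m = (ups P m + j).+1.
  move=> ms; have [mN jm mn] := max_tile_valid T ms.
  have mN' : m <= N by lia.
  have um := rights_eq P mN'; have rk := rights_le P mN'.
  have [b bt [ib yb]] := tile_box T ms.
  have bp := subsetP sub _ bt; rewrite in_region ib yb in bp.
  have := inp' b; rewrite bt /= in_region ib yb => /negbT; rewrite -ltnNge => bp'.
  have up_le := ups_le p' mN'; have e' := rights_eq p' mN'.
  have e : ups p m = ups P m + j.
    apply/eqP; rewrite eqn_leq bp leqNgt; apply/negP => lt.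
    have [||c [ic yc]] := @path_box p m mN'; try lia.
    have : c \in region_above p' by rewrite inp' inE ic yc in_region ic yc leqnn; lia.
    by rewrite in_region ic yc; lia.
  split=> //; apply/eqP; rewrite eqn_leq bp' andbT leqNgt; apply/negP => lt.
  have [|||c [ic yc]] := @box_at k n m (ups P m + j).+1; try lia.
  have : c \in region_above p' by rewrite inp' inE ic yc in_region ic yc; lia.
  by rewrite in_region ic yc; lia.
split=> [m /on[]//|m mN].
case: (boolP (s <= m <= t)) => ms; first by have [-> ->] := on m ms; rewrite addn1.
rewrite addn0; have same b : index_of b = m -> (b \in region_above p') = (b \in region_above p).
  by move=> ib; rewrite inp' inE ib (negPf ms).
have e := rights_eq p mN; have e' := rights_eq p' mN.
have u := ups_le p mN; have u' := ups_le p' mN.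
apply/eqP; rewrite eqn_leq; apply/andP; split; rewrite leqNgt; apply/negP => lt.
  have [||c [ic yc]] := @path_box p m mN; try lia.
  by have := same c ic; rewrite !in_region ic yc; lia.
have [||c [ic yc]] := @path_box p' m mN; try lia.
by have := same c ic; rewrite !in_region ic yc; lia.
Qed.

Lemma height_ups_eq m m' : m < m' <= N -> ups P m = ups P m' -> h m' < h m.
Proof.
move=> mm e; have := height_eq P (m := m) ltac:(lia); have := height_eq P (m := m') ltac:(lia).
have := rights_eq P (m := m) ltac:(lia); have := rights_eq P (m := m') ltac:(lia).
rewrite e; lia.
Qed.

Lemma southmost_start p j s t i : max_tile P j s t ->
  southmost_edge p (tile_set P j s t) i -> i = s /\ ~~ letter p s.
Proof.
move=> T [b [bt bmin]]; have [[stN hst hm] _ _] := T; have [br ib lb yb] := tile_setP T bt.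
have [|b0 b0t [ib0 yb0]] := @tile_box _ _ _ _ _ _ s T; first lia.
have := bmin b0 b0t; rewrite yb yb0 leq_add2r => us.
have es : index_of b = s.
  apply/eqP; rewrite eqn_leq; case/andP: ib => -> ib; rewrite andbT leqNgt; apply/negP => lt.
  have := @height_ups_eq s (index_of b); have := @leq_ups P s (index_of b).
  by have := hm (index_of b); lia.
case/and3P=> /andP[i0 iN] /eqP li /eqP [e1 e2].
have ei : i.-1 = b.1 + b.2.
  have := ups_rights (w := p) (m := i.-1); rewrite /ups /rights e1 e2 => <- /=; last lia.
  by rewrite addnC.
have ii : i = s by rewrite -es /index_of -ei prednK.
by split=> //; rewrite -ii; case: (letter p i) li.
Qed.

Definition depth p m : nat := ups p m - ups P m.

(** p lies above P, and the boxes between P and p form whole tiles of the maximal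
tiling: boxes joined in a layer are below p together. *)
Definition tile_state p : Prop :=
  (forall m, m <= N -> ups P m <= ups p m) /\
  (forall j m m', joined P j m m' -> j < depth p m -> j < depth p m').

Lemma tile_state0 : tile_state P.
Proof. by split=> // j m m' _; rewrite /depth subnn. Qed.

Lemma tile_state_step p p' j s t : max_tile P j s t -> tile_state p ->
  (forall m, s <= m <= t -> ups p m = ups P m + j) ->
  (forall m, m <= N -> ups p' m = ups p m + (s <= m <= t)) -> tile_state p'.
Proof.
move=> T [le E] on up'.
split=> [m mN|j' m m' jm]; first by rewrite up' // (leq_trans (le m mN)) // leq_addr.
have [mN _ _] := joined_valid jm.
have [mN' _ _] := joined_valid (etrans (joined_sym _ _ _ _) jm).
have := E _ _ _ jm; rewrite /depth !up'; try lia.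
have := le m ltac:(lia); have := le m' ltac:(lia).
case: (boolP (s <= m <= t)) => ms; last by lia.
have := on m ms; case: (ltngtP j' j) => c; try lia.
subst j'; have ms' := max_tile_closed T ms jm; have := on m' ms'; rewrite ms'; lia.
Qed.

Lemma region0_ups p m : region_above p = set0 -> m <= N -> ups p m = minn m n.
Proof.
move=> r0 mN; have := ups_le p mN; have := rights_eq p mN => e u.
apply/eqP; rewrite eqn_leq; apply/andP; split; first by rewrite leq_min; lia.
rewrite leqNgt; apply/negP => lt.
have [||b [ib yb]] := @path_box p m mN; try lia.
have : b \in region_above p by rewrite in_region ib yb.
by rewrite r0 inE.
Qed.

Hypothesis k0 : 0 < k.

Lemma height_rights_eq m m' : m < m' <= N -> rights P m = rights P m' -> h m < h m'.
Proof.
move=> mm e; have := height_eq P (m := m) ltac:(lia); have := height_eq P (m := m') ltac:(lia).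
have := rights_eq P (m := m) ltac:(lia); have := rights_eq P (m := m') ltac:(lia).
rewrite e => e1 e2; have : k * ups P m < k * ups P m' by rewrite ltn_pmul2l //; lia.
lia.
Qed.

Lemma rightmost_end p j s t i : max_tile P j s t ->
  rightmost_edge p (tile_set P j s t) i -> i = t.+1 /\ letter p t.+1.
Proof.
move=> T [b [bt bmax]]; have [[stN hst hm] _ _] := T; have [br ib lb yb] := tile_setP T bt.
have [|b0 b0t [ib0 yb0]] := @tile_box _ _ _ _ _ _ t T; first lia.
have x : (nat_of_ord b.1 + nat_of_ord b.2).+1 = index_of b by [].
have x0 : (nat_of_ord b0.1 + nat_of_ord b0.2).+1 = index_of b0 by [].
have le1 : nat_of_ord b0.1 <= nat_of_ord b.1 := bmax b0 b0t.
have es : index_of b = t.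
  apply/eqP; rewrite eqn_leq; case/andP: ib => ib1 ib2; rewrite ib2 leqNgt; apply/negP => lt.
  have := @height_rights_eq (index_of b) t; have := @leq_rights P (index_of b) t.
  have := rights_eq P (m := index_of b) ltac:(lia); have := rights_eq P (m := t) ltac:(lia).
  have := hm (index_of b) ltac:(lia); rewrite ib0 in x0.
  by lia.
case/and3P=> /andP[i0 iN] /eqP li /eqP [e1 e2].
have ei : i.-1 = b.1.+1 + b.2.
  have := ups_rights (w := p) (m := i.-1); rewrite /ups /rights e1 e2 => <- /=; last lia.
  by rewrite addnC.
have ii : i = t.+1 by rewrite -es -x -(prednK i0) ei.
by split=> //; rewrite -ii li.
Qed.

Lemma tile_addable p j s t : max_tile P j s t ->
  (forall m, s <= m <= t -> ups p m = ups P m + j) ->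
  ~~ letter p s -> letter p t.+1 ->
  exists p', [/\ add_tile p (tile_set P j s t) p',
                 southmost_edge p (tile_set P j s t) s &
                 rightmost_edge p (tile_set P j s t) t.+1].
Proof.
move=> T e ls lt; have [[stN hst hm] [js tn] _] := T.
have [sN _ _] := max_tile_valid T (m := s) ltac:(lia).
have [tN _ _] := max_tile_valid T (m := t) ltac:(lia).
pose w := [tuple of [seq letter p (exchange s t.+1 x) | x <- iota 1 N]].
have lw x : 0 < x <= size p -> letter w x = letter p (exchange s t.+1 x).
  rewrite size_dyck; case: x => // x xN.
  by rewrite {1}/letter (nth_map 0) ?size_iota // nth_iota // add1n.
have uw m : m <= N -> ups w m = ups p m + (s <= m <= t).
  move=> mN; have := @ups_exchange p w s t.+1 m; rewrite !size_tuple => /(_ erefl).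
  rewrite size_dyck in lw; move=> /(_ ltac:(lia) ltac:(lia) lw mN).
  by rewrite (negPf ls) lt muln0 muln1 ltnS addn0.
have dw : is_kdyck k n w.
  apply: dyck_of_ups => [|m mN].
    rewrite uw // ups_size; have -> : (s <= N <= t) = false by lia.
    by rewrite addn0.
  have := ups_rights (w := w) (m := m); rewrite size_tuple => /(_ mN).
  have := rights_eq p mN; have := dyck_ge p mN.
  have := leq_mul (leqnn k) (_ : ups p m <= ups w m); rewrite uw // leq_addr => /(_ isT).
  lia.
pose p' := Dyck dw.
have up' m : m <= N -> ups p' m = ups p m + (s <= m <= t) by apply: uw.
exists p'; split.
- split.
    apply/subsetP => b bt; have [br ib lb yb] := tile_setP T bt.
    by rewrite in_region e // yb.
  apply/setP => b; rewrite in_setD !in_region inE; have bN := index_lt b.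
  rewrite up'; last lia.
  case: (boolP (s <= index_of b <= t)) => ib; last by rewrite addn0.
  by rewrite e //=; case: eqP => [->|ne]; lia.
- have [|b bt [ib yb]] := @tile_box _ _ _ _ _ _ s T; first lia.
  exists b; split=> //.
    move=> b' bt'; have [br' ib' lb' yb'] := tile_setP T bt'.
    by rewrite yb yb' leq_add2r leq_ups //; lia.
  have x : (nat_of_ord b.1 + nat_of_ord b.2).+1 = index_of b by [].
  apply/and3P; split; [by rewrite size_dyck; lia | by rewrite (negPf ls) |].
  have u1 : ups p s.-1 = nat_of_ord b.2.
    have := e s ltac:(lia); have := @ups_stepP _ _ p s.-1 ltac:(lia).
    rewrite prednK; last lia.
    by rewrite (negPf ls); case=> -[// _ <- _]; lia.
  have := rights_eq p (m := s.-1) ltac:(lia) => r1.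
  have r2 : rights p s.-1 = nat_of_ord b.1 by lia.
  by rewrite /step_start -/(ups p _) -/(rights p _) u1 r2.
have [|b bt [ib yb]] := @tile_box _ _ _ _ _ _ t T; first lia.
have x : (nat_of_ord b.1 + nat_of_ord b.2).+1 = index_of b by [].
have et := rights_eq P (m := t) ltac:(lia).
exists b; split=> //.
  move=> b' bt'; have [br' ib' lb' yb'] := tile_setP T bt'.
  have x' : (nat_of_ord b'.1 + nat_of_ord b'.2).+1 = index_of b' by [].
  have := @leq_rights P (index_of b') t ltac:(lia).
  have := rights_eq P (m := index_of b') ltac:(lia) => e1 e2.
  by have : nat_of_ord b'.1 <= nat_of_ord b.1 by lia.
apply/and3P; split; [by rewrite size_dyck; lia | by rewrite lt |].
have u1 := e t ltac:(lia); have r1 := rights_eq p (m := t) ltac:(lia).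
have u2 : ups p t = nat_of_ord b.2 by lia.
have r2 : rights p t = (nat_of_ord b.1).+1 by lia.
by rewrite /step_start /= -/(ups p _) -/(rights p _) u2 r2.
Qed.

(** Take a remaining box that minimizes height plus k + 1 times the layer. Its tile
can be added, since any tile that has to come before contains a box of smaller
value: one layer less counts for k + 1, while next to the ends of the tile the
height grows by at most k, and falls if the layer is the same. *)
Lemma next_tile p : tile_state p -> region_above p != set0 ->
  exists j s t, [/\ max_tile P j s t,
    forall m, s <= m <= t -> ups p m = ups P m + j,
    ~~ letter p s & letter p t.+1].
Proof.
move=> [le E] /set0Pn[b1 b1p].
pose F b := h (index_of b) + layer P b * k.+1.
case: (arg_minnP F b1p) => b bp' bmin; have bp : b \in region_above p := bp'.
have regP c : c \in region_above p -> c \in region_above P.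
  by rewrite !in_region; have := index_lt c => cN; have := le (index_of c) ltac:(lia); lia.
have bP := regP b bp; have [jb bn] := region_valid bP; have bN := index_lt b.
have [|s [t [T ib]]] := max_tile_exists _ jb bn; first lia.
set j := layer P b in jb bn T; have [[stN hst hm] [js tn] _] := T.
have [sN _ _] := max_tile_valid T (m := s) ltac:(lia).
have [tN _ _] := max_tile_valid T (m := t) ltac:(lia).
have dep m : m <= N -> ups p m = ups P m + depth p m by move=> mN; rewrite subnKC ?le.
have fmin m j' : m <= N -> j' < rights P m -> ups P m + j' < n -> depth p m <= j' ->
    h s + j * k.+1 <= h m + j' * k.+1.
  move=> mN jm mn dj; have [c [cP ic lc yc]] := box_in mN jm mn.
  have cp : c \in region_above p by rewrite in_region ic yc dep // leq_add2l.
  have := bmin c cp; rewrite /F ic lc -/j; have := hm (index_of b) ib; lia.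
have djs : depth p (index_of b) <= j.
  have := bp; rewrite in_region (layer_eq bP) -/j dep ?leq_add2l //; lia.
have dms m : s <= m <= t -> depth p m = j.
  move=> ms; have [mN _ _] := max_tile_valid T ms.
  have h1 : depth p m <= j.
    rewrite leqNgt; apply/negP => lt; have jm := max_tile_joined T ms ib.
    by have := E _ _ _ jm lt; lia.
  apply/eqP; rewrite eqn_leq h1 leqNgt; apply/negP => lt.
  have h2 : depth p s <= j.-1.
    rewrite leqNgt; apply/negP => lt'.
    have sm : joined P j.-1 s m.
      by apply: (@joined_layer _ _ _ j); [lia | apply: (max_tile_joined T); lia].
    by have := E _ _ _ sm lt'; lia.
  have := fmin s j.-1 ltac:(lia) ltac:(lia).
  have := leq_ups P (m1 := s) (m2 := t) ltac:(lia).
  have -> : j * k.+1 = j.-1 * k.+1 + k.+1 by rewrite -{1}(prednK (_ : 0 < j)) ?mulSn; lia.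
  lia.
have on m : s <= m <= t -> ups p m = ups P m + j.
  by move=> ms; have [mN _ _] := max_tile_valid T ms; rewrite dep ?dms //; lia.
have jS : 0 < j -> j * k.+1 = j.-1 * k.+1 + k.+1.
  by move=> j0; rewrite -{1}(prednK j0) mulSn addnC.
exists j, s, t; split=> //.
- apply/negP => ls; have es := on s ltac:(lia).
  have s1N : s.-1 < N by lia.
  have := dep s.-1 ltac:(lia); have lP := le s.-1 ltac:(lia).
  have := ups_stepP p s1N; have := ups_stepP P s1N; have := height_stepP P s1N.
  rewrite prednK; last lia.
  rewrite ls => hstep; case=> -[lPs uP rP]; case=> -[// _ up rp] dp; rewrite lPs in hstep.
  + have := fmin s.-1 j ltac:(lia) ltac:(lia).
    have := leq_ups P (m1 := s.-1) (m2 := t) ltac:(lia).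
    by case: hstep => -[] *; lia.
  have j1 : 0 < j by lia.
  have := fmin s.-1 j.-1 ltac:(lia) ltac:(lia); rewrite jS //.
  have := leq_ups P (m1 := s.-1) (m2 := t) ltac:(lia).
  by rewrite (negPf lPs) in hstep; case: hstep => -[] *; lia.
apply/negPn/negP => lt; have et := on t ltac:(lia).
have tN1 : t < N by lia.
have := dep t.+1 ltac:(lia); have lP := le t.+1 ltac:(lia).
have := ups_stepP p tN1; have := ups_stepP P tN1; have := height_stepP P tN1.
rewrite (negPf lt) => hstep; case=> -[lPs uP rP]; case=> -[// _ up rp] dp; rewrite lPs in hstep.
  have j1 : 0 < j by lia.
  have := fmin t.+1 j.-1 ltac:(lia); have := leq_rights P (m1 := s) (m2 := t) ltac:(lia).
  by rewrite jS //; case: hstep => -[] *; lia.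
have := fmin t.+1 j ltac:(lia); have := leq_rights P (m1 := s) (m2 := t) ltac:(lia).
by rewrite (negPf lPs) in hstep; case: hstep => -[] *; lia.
Qed.

Lemma tiles_trivIset d d' b : d \in Dmax P -> d' \in Dmax P -> b \in d -> b \in d' -> d = d'.
Proof.
move=> dM dM' bd bd'; have /trivIsetP tr : trivIset (Dmax P) by case/and3P: (Dmax_partition P).
apply/eqP/negPn/negP => ne; have /pred0P/(_ b) := tr d d' dM dM' ne.
by rewrite /= bd bd'.
Qed.

Lemma add_order_exists p : tile_state p ->
  exists ds, [/\ uniq ds, ds =i [pred d in Dmax P | d \subset region_above p] &
                 forall B, exists B', add_tiles p B ds B'].
Proof.
have [q qp] := ubnP #|region_above p|; elim: q p qp => // q IHq p qp st.
case: (eqVneq (region_above p) set0) => [e|ne].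
  exists [::]; split=> // [d|B]; last by exists B; constructor.
  rewrite inE e subset0; apply/esym/andP => -[dM /eqP d0].
  by rewrite d0 in dM; case/and3P: (Dmax_partition P) => _ _ /negP.
have [j [s [t [T on ls lt]]]] := next_tile st ne.
have [p' [ad so ri]] := tile_addable T on ls lt.
set d := tile_set P j s t in ad so ri.
have dM : d \in Dmax P by apply/DmaxP; exists j, s, t.
have [_ up'] := add_tile_ups T ad; have [sub reg] := ad.
have st' := tile_state_step T st on up'.
have [[stN _ _] _ _] := T.
have [|b bt _] := @tile_box _ _ _ _ _ _ s T; first lia.
have lt' : #|region_above p'| < q.
  rewrite -ltnS (leq_trans _ qp) // ltnS reg; apply: proper_card.
  rewrite properEneq subsetDl andbT; apply/eqP => /setP/(_ b).
  by rewrite inE bt (subsetP sub).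
have [ds [uds dsE dsB]] := IHq p' lt' st'.
exists (d :: ds); split=> [|d'|B].
- rewrite /= uds andbT dsE inE negb_and; apply/orP; right.
  by apply/negP => /subsetP/(_ b bt); rewrite reg inE bt.
- rewrite inE dsE !inE reg subsetD.
  case: (eqVneq d' d) => [->|nd] /=; first by rewrite dM sub.
  case dM': (d' \in Dmax P) => //=; case: (d' \subset _) => //=.
  apply/pred0P => c /=; apply/andP => -[cd' cd].
  by case/eqP: nd; apply: tiles_trivIset cd' cd.
have [B' aB] := dsB (exchange_blocks s t.+1 B).
by exists B'; apply: AddCons ad so ri aB.
Qed.

End AddTile.


(** * Where the letters go *)

Section Labels.
Variables k n : nat.
Notation N := (k.+1 * n).
Variable P : dyck k n.
Notation h := (height k P).
Notation par := (partner P).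
Notation last_of := (last_of P).
Implicit Types (p : dyck k n) (f : nat -> nat).

(** There are fewer right steps before u than up steps after its block. Then the
window of the layers, which loses one right step on the left and one up step on
the right at a time, uncovers the block from the left, so the up step is out of
reach. Otherwise the last right step of the block is out of reach. *)
Definition pinned (u : nat) : bool := rights P u + ups P (last_of u) < n.

(** No up step of p lies beyond the last right step of u any more. From then on
right steps beyond it belong to blocks whose up step is on the left of that of u,
and right steps between it and another one of u do not. *)
Definition sealed (p : dyck k n) (f : nat -> nat) (u : nat) : Prop :=
  [/\ n <= ups p (last_of u),
      forall r, 0 < r <= N -> ~~ letter P r -> last_of u < f r -> f (par r) < f u &
      forall r0 r, 0 < r0 <= N -> 0 < r <= N -> ~~ letter P r0 -> ~~ letter P r ->
        par r0 = u -> f r0 < f r < last_of u -> f u <= f (par r)].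

(** Meant for a block whose up step stays at u, so that u is its label. *)
Definition overtaken (f : nat -> nat) (u : nat) : Prop :=
  exists r', [/\ 0 < r' <= N, ~~ letter P r', u < f (par r') &
    forall r, 0 < r <= N -> par r = u -> f r < f r'].

(** Invariant of the path p and of the current positions f of the letters of P.
The clause [st_fix] says that a position has not been touched if the two points
next to it were always covered by the same tile. *)
Record state (p : dyck k n) (f : nat -> nat) : Prop := State {
  st_tiles : tile_state P p;
  st_fix : forall q, 0 < q <= N -> depth P p q.-1 = depth P p q ->
    (depth P p q = 0 \/ joined P (depth P p q).-1 q.-1 q) -> f q = q;
  st_inj : injective f;
  st_range : forall x, 0 < x <= N -> 0 < f x <= N;
  st_surj : forall y, 0 < y <= N -> exists2 x, 0 < x <= N & f x = y;
  st_letter : forall x, 0 < x <= N -> letter p (f x) = letter P x;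
  st_up : forall x, 0 < x <= N -> letter P x -> f x <= x;
  st_right : forall x, 0 < x <= N -> ~~ letter P x -> x <= f x;
  st_free : forall u, 0 < u <= N -> letter P u -> ~~ pinned u ->
    f (last_of u) = last_of u /\
    ((forall x, u <= x <= last_of u -> f x = x) \/ sealed p f u);
  st_pinned : forall u, 0 < u <= N -> letter P u -> pinned u ->
    f u = u /\
    ((forall x, 0 < x <= N -> par x = u -> f x = x) /\
       rights p u + ups p (last_of u) < n \/
     (exists2 x, 0 < x <= N & par x = u /\ f x <> x) /\ overtaken f u) }.

Lemma state0 : state P id.
Proof.
split=> //; first exact: tile_state0.
- by move=> y yN; exists y.
- by move=> u uN lu _; split=> //; left.
by move=> u uN lu pu; split=> //; left.
Qed.

Lemma up_before p m y : n <= ups p m -> y <= N -> letter p y -> y <= m.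
Proof.
case: y => // y um yN ly; rewrite ltnNge; apply/negP => my.
case: (ups_stepP p yN) => -[l e _]; last by rewrite ly in l.
by have := leq_ups p my; have := ups_le p yN; lia.
Qed.

Lemma up_after p m : m <= N -> ups p m < n -> exists2 y, m < y <= N & letter p y.
Proof.
move=> mN um; case: (boolP (has (letter p) (iota m.+1 (N - m)))) => [/hasP[y]|/hasPn nl].
  by rewrite mem_iota => my ly; exists y => //; lia.
suff H i : m + i <= N -> ups p (m + i) = ups p m.
  by have := H (N - m); rewrite subnKC // ups_size; lia.
elim: i => [|i IHi] iN; first by rewrite addn0.
rewrite addnS in iN *; rewrite -IHi; last lia.
case: (ups_stepP p iN) => -[l e _] //.
by have := nl (m + i).+1; rewrite mem_iota l => /(_ ltac:(lia)).
Qed.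

Lemma right_rights u : 0 < u <= N -> letter P u -> rights P u.-1 = rights P u.
Proof.
case: u => // u uN lu; case: (ups_stepP P uN) => -[l _ e] //.
by rewrite lu in l.
Qed.

Hypothesis k0 : 0 < k.

(** In an untouched block the order is still that of the matching, and up steps
that are not inside it lie to its left. *)
Lemma seal p f u : state p f -> 0 < u <= N -> letter P u -> n <= ups p (last_of u) ->
  (forall x, u <= x <= last_of u -> f x = x) -> sealed p f u.
Proof.
move=> S uN lu nu fx; have [pl ul nl b [_ bl]] := last_ofP k0 uN lu; split=> //.
  move=> r rN lr fr; have [pr hp hpm] := partnerP P rN.
  have pN : 0 < par r <= N by lia.
  have lpr := partner_letter P rN.
  have le : f (par r) <= last_of u.
    have := st_range S pN; have := st_letter S pN; rewrite lpr => l fN.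
    by apply: up_before nu _ l; lia.
  rewrite (fx u); last lia.
  rewrite ltnNge; apply/negP => le'.
  have e : f (par r) = par r by apply: (st_inj S); apply: fx; lia.
  have : u.-1 < r <= last_of u.
    apply: (balanced_block_mem k0 b (x := par r)) => //; first lia.
    by rewrite partner_idem.
  by move=> ru; have := fx r; lia.
move=> r0 r r0N rN lr0 lr pr0 fr.
have er0 := fx r0 (bl r0 r0N pr0); have ur0 := bl r0 r0N pr0.
have fr' : f r = r by apply: (st_inj S); apply: fx; lia.
have [pr hp hpm] := partnerP P rN.
have : u.-1 < par r by have [] := balanced_block k0 b (x := r); lia.
by move=> upr; rewrite !fx; lia.
Qed.

Section Step.
Variables (p p' : dyck k n) (f : nat -> nat) (j s t : nat).
Hypothesis S : state p f.
Hypothesis T : max_tile P j s t.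
Hypothesis on : forall m, s <= m <= t -> ups p m = ups P m + j.
Hypothesis ls : ~~ letter p s.
Hypothesis lt : letter p t.+1.
Hypothesis up' : forall m, m <= N -> ups p' m = ups p m + (s <= m <= t).

Notation f' := (fun x => exchange s t.+1 (f x)).

Lemma step_bounds : [/\ 0 < s, s <= t & t < N].
Proof.
have [[stN _ _] _ _] := T.
have [sN _ _] := max_tile_valid T (m := s) ltac:(lia).
have [tN _ _] := max_tile_valid T (m := t) ltac:(lia).
by split; lia.
Qed.

Lemma step_window : j < rights P s /\ ups P t + j < n.
Proof. by case: T. Qed.

Lemma step_depth m : s <= m <= t -> depth P p m = j.
Proof. by move=> ms; rewrite /depth on // addKn. Qed.

Lemma stepP x : 0 < x <= N ->
  [\/ [/\ f x = s, ~~ letter P x & exchange s t.+1 (f x) = t.+1],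
      [/\ f x = t.+1, letter P x & exchange s t.+1 (f x) = s] |
      [/\ f x <> s, f x <> t.+1 & exchange s t.+1 (f x) = f x]].
Proof.
move=> xN; have l := st_letter S xN; rewrite /exchange.
case: (eqVneq (f x) s) => [e|ns]; first by constructor 1; rewrite -l e.
case: (eqVneq (f x) t.+1) => [e|nt]; first by constructor 2; rewrite -l e.
by constructor 3; split=> //; apply/eqP.
Qed.

(** The tiles added below the new one contain its points, so none of them ends
strictly inside it. *)
Lemma inside_fixed q : s < q <= t -> f q = q.
Proof.
move=> qs; have [s1 st tN] := step_bounds.
apply: (st_fix S); first lia; rewrite !step_depth //; try lia.
case: (posnP j) => [->|j1]; [by left | right].
by apply: (@joined_layer _ _ _ j); [lia | apply: (max_tile_joined T); lia].
Qed.

Lemma inside_origin x : s < f x <= t -> f x = x.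
Proof. by move=> /inside_fixed/(st_inj S). Qed.

Lemma inside_block x y : 0 < x <= N -> s < f x <= t -> 0 < y <= N -> par y = par x ->
  s < y <= t /\ f y = y.
Proof.
move=> xN fx yN e; have ex := inside_origin fx; rewrite ex in fx.
have [b _ _] := T; have ys := balanced_block_mem k0 b fx yN e.
by split=> //; apply: inside_fixed.
Qed.

(** A block inside the window of layer j joins its points there, so it cannot
contain an end of the tile. *)
Lemma tile_touches u : 0 < u <= N -> letter P u ->
  (u <= s <= last_of u) || (u <= t.+1 <= last_of u) ->
  rights P u <= j \/ n <= ups P (last_of u) + j.
Proof.
move=> uN lu touch; have [_ ul _ b _] := last_ofP k0 uN lu.
case: (leqP (rights P u) j) => c1; first by left.
case: (leqP n (ups P (last_of u) + j)) => c2; first by right.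
have [s1 st tN] := step_bounds.
have J m m' : u.-1 <= m <= last_of u -> u.-1 <= m' <= last_of u -> joined P j m m'.
  by move=> mu mu'; apply/joinedP; exists u.-1, (last_of u); rewrite right_rights.
have [_ _ cl] := T; case/orP: touch => tu.
  by have := cl u.-1 (J s u.-1 ltac:(lia) ltac:(lia)); lia.
have := max_tile_closed T (m := t) (m' := t.+1) ltac:(lia) (J t t.+1 ltac:(lia) ltac:(lia)).
lia.
Qed.

Lemma pinned_fixed u : 0 < u <= N -> letter P u -> pinned u -> f u = u -> u <> s /\ u <> t.+1.
Proof.
move=> uN lu pu fu; have [s1 st tN] := step_bounds; have [js tn] := step_window.
split=> e.
  by have := st_letter S uN; rewrite fu lu e => l; move: ls; rewrite l.
have [_ ul _ _ _] := last_ofP k0 uN lu.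
have := tile_touches uN lu; rewrite /pinned in pu.
have := leq_rights P (m1 := s) (m2 := u) ltac:(lia).
by rewrite -e leqnn /=; lia.
Qed.

Lemma free_fixed u : 0 < u <= N -> letter P u -> ~~ pinned u ->
  last_of u <> s /\ last_of u <> t.+1.
Proof.
move=> uN lu; rewrite -leqNgt => pu; have [s1 st tN] := step_bounds.
have [js tn] := step_window; have [_ ul nl _ _] := last_ofP k0 uN lu.
have := tile_touches uN lu; split=> e; rewrite e in H ul nl pu.
  by have := leq_ups P (m1 := s) (m2 := t) ltac:(lia); lia.
have := @ups_stepP _ _ P t tN; rewrite (negPf nl) => -[[]// | [_ e' _]]; lia.
Qed.

(** A tile ends inside the block only when the window of its layer has lost the end
of the block. The tile of the last earlier layer that covered the whole block has
then lifted p so much that all up steps come before. *)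
Lemma free_touched u : 0 < u <= N -> letter P u -> ~~ pinned u ->
  (u <= s <= last_of u) || (u <= t.+1 <= last_of u) -> n <= ups p (last_of u).
Proof.
move=> uN lu pu touch; have [s1 st tN] := step_bounds.
have [_ ul nl b _] := last_ofP k0 uN lu; rewrite -leqNgt in pu.
have [le E] := st_tiles S; have lv := le (last_of u) ltac:(lia).
case: (leqP n (ups P (last_of u))) => c; first by lia.
have jn : n - ups P (last_of u) <= j by have := tile_touches uN lu touch; lia.
set j0 := n - _ in jn; have j01 : 0 < j0 by rewrite /j0; lia.
have J m m' : u.-1 <= m <= last_of u -> u.-1 <= m' <= last_of u -> joined P j0.-1 m m'.
  move=> mu mu'; apply/joinedP; exists u.-1, (last_of u); rewrite right_rights //.
  by split=> //; rewrite /j0; lia.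
suff : j0.-1 < depth P p (last_of u) by rewrite /depth /j0; lia.
case/orP: touch => tu.
  by apply: (E _ s) => //; [apply: J; lia | rewrite step_depth; lia].
by apply: (E _ t) => //; [apply: J; lia | rewrite step_depth; lia].
Qed.

Lemma step_mono_up x : 0 < x <= N -> letter P x -> exchange s t.+1 (f x) <= f x.
Proof.
move=> xN lx; have [s1 st tN] := step_bounds.
by case: (stepP xN) => -[]; rewrite ?lx //; lia.
Qed.

Lemma step_mono_right x : 0 < x <= N -> ~~ letter P x -> f x <= exchange s t.+1 (f x).
Proof.
move=> xN lx; have [s1 st tN] := step_bounds.
by case: (stepP xN) => -[]; rewrite ?(negPf lx) //; lia.
Qed.

(** The exchange takes place before the last right step of u. It changes the order
of two up steps or of two right steps only if one of them lies inside the tile,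
hence with its whole block, which is neither the block of u nor reaches beyond
it. *)
Lemma sealed_step u : 0 < u <= N -> letter P u -> ~~ pinned u ->
  f (last_of u) = last_of u -> sealed p f u -> sealed p' f' u.
Proof.
move=> uN lu pu fv [nu C1 C2]; have [s1 st tN] := step_bounds.
have [pl ul nl b _] := last_ofP k0 uN lu; have [vs vt] := free_fixed uN lu pu.
have tv : t.+1 < last_of u by have := up_before nu tN lt; lia.
have notin x : 0 < x <= N -> par x = u -> s < f x <= t -> False.
  move=> xN px fx; have vN : 0 < last_of u <= N by lia.
  by have := inside_block xN fx vN; rewrite pl px => /(_ erefl); lia.
have paru := partner_up uN lu.
split; first by rewrite up' ?(leq_trans nu) ?leq_addr //; lia.
  move=> r rN lr vr; have [pr _ _] := partnerP P rN.
  have pN : 0 < par r <= N by lia.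
  have lpr := partner_letter P rN.
  have fr : f r = exchange s t.+1 (f r).
    by case: (stepP rN) => -[] *; rewrite ?(negPf lr) // in vr *; lia.
  rewrite -fr in vr; have {}C1 := C1 r rN lr vr.
  case: (stepP pN) => -[fp lp ->]; rewrite ?lpr // in lp.
    by case: (stepP uN) => -[fu lu' ->]; rewrite ?lu // in lu' *; lia.
  case: (stepP uN) => -[fu lu' ->]; rewrite ?lu // in lu' *.
  case: (ltngtP (f (par r)) s) => // c.
  have := inside_block pN (y := r) ltac:(lia) rN; rewrite partner_idem // => /(_ erefl); lia.
move=> r0 r r0N rN lr0 lr pr0 fr; have [pr _ _] := partnerP P rN.
have pN : 0 < par r <= N by lia.
have lpr := partner_letter P rN.
case: (eqVneq (par r) u) => [->//|npr].
have {}C2 : f u <= f (par r).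
  apply: (C2 r0 r) => //; have m0 := step_mono_right r0N lr0; have m1 := step_mono_right rN lr.
  case: (stepP rN) => -[fr1 lr1 e1]; rewrite ?(negPf lr) // in lr1; last by lia.
  have := notin r0 r0N pr0.
  case: (stepP r0N) => -[fr2 lr2 e2]; rewrite ?(negPf lr0) // in lr2; last by lia.
  by case/eqP: npr; rewrite -pr0; congr par; apply: (st_inj S); rewrite fr1 fr2.
have ne : f u <> f (par r) by move/(st_inj S) => e; rewrite -e eqxx in npr.
have mu := step_mono_up uN lu.
case: (stepP pN) => -[fp lp e]; rewrite ?lpr // in lp; last by lia.
have := notin u uN paru.
by case: (stepP uN) => -[fu lu' ->]; rewrite ?lu // in lu' *; lia.
Qed.

(** If all right steps of u stay at or before t + 1, the block whose up step now
moves from t + 1 to s overtakes u, because its right steps lie beyond t + 1. *)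
Lemma overtaken_end u : 0 < u <= N -> letter P u -> u < s ->
  (forall r, 0 < r <= N -> par r = u -> f r <= t) -> overtaken f' u.
Proof.
move=> uN lu us fr; have [s1 st tN] := step_bounds.
have [x xN fx] := st_surj S (y := t.+1) ltac:(lia).
have lx : letter P x by rewrite -(st_letter S xN) fx.
have [pl xl nl _ _] := last_ofP k0 xN lx; have lN : 0 < last_of x <= N by lia.
exists (last_of x); split=> //=.
  by rewrite pl; case: (stepP xN) => -[e1 e2 ->]; rewrite ?lx // in e2 *; lia.
move=> r rN pr; have := fr r rN pr; have := step_mono_right lN nl.
have := st_right S lN nl; have := st_up S xN lx; rewrite fx.
by case: (stepP rN) => -[e1 e2 ->]; lia.
Qed.

Lemma step_letter y : 0 < y <= N -> letter p' y = letter p (exchange s t.+1 y).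
Proof.
case: y => // y yN; have [s1 st tN] := step_bounds.
have yN' : y < N by lia.
have uy := up' (ltnW yN'); have uy1 := up' yN'.
have := ups_stepP p yN'; have := ups_stepP p' yN'; rewrite uy uy1 /exchange.
case: (eqVneq y.+1 s) => [e|ns].
  have ls' := ls; rewrite -e in ls'; rewrite lt.
  case=> -[l' e1' _]; case=> -[l e1 _]; rewrite ?l // in ls' *; lia.
case: (eqVneq y.+1 t.+1) => [[e]|nt].
  have lt' := lt; rewrite -e in lt'; rewrite (negPf ls).
  case=> -[l' e1' _]; case=> -[l e1 _]; rewrite ?lt' // in l *; lia.
have -> : (s <= y.+1 <= t) = (s <= y <= t) by lia.
by case=> -[l e _]; case=> -[l' e' _]; lia.
Qed.

(** As long as the block is untouched, a tile passing over it takes away one right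
step before u and one up step after the block, so that an up step beyond the block
remains. When a right step of the block moves for the first time, the block of
such an up step overtakes u. Later a right step of u can only pass the right step
of the witness if the latter lies inside the tile, and then [overtaken_end]
gives a new witness. *)
Lemma pinned_step u : 0 < u <= N -> letter P u -> pinned u -> f' u = u /\
  ((forall x, 0 < x <= N -> par x = u -> f' x = x) /\
       rights p' u + ups p' (last_of u) < n \/
     (exists2 x, 0 < x <= N & par x = u /\ f' x <> x) /\ overtaken f' u).
Proof.
move=> uN lu pu; have [s1 st tN] := step_bounds.
have [fu ph] := st_pinned S uN lu pu; have [us ut] := pinned_fixed uN lu pu fu.
have fu' : f' u = u by case: (stepP uN) => -[e1 e2 ->]; lia.
have [pl ul nl bu [_ bl]] := last_ofP k0 uN lu; have vN : 0 < last_of u <= N by lia.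
have paru := partner_up uN lu.
split=> //; case: ph => [[whole cnt]|[[x0 x0N [px0 fx0]] [r' [r'N lr' ur' fr']]]].
  have fv := whole _ vN pl.
  have sN : 0 < s <= N by lia.
  case: (eqVneq (par s) u) => [ps|ps].
    right; split.
      exists s => //; split=> //; rewrite whole // /exchange eqxx; lia.
    have := bl s sN ps => usv.
    case: (leqP (last_of u) t) => vt.
      have es : last_of u = s.
        apply/eqP; rewrite eqn_leq; case/andP: usv => _ ->; rewrite andbT leqNgt.
        apply/negP => sv; have := inside_block vN (y := s).
        by rewrite fv pl ps sv vt => /(_ isT sN erefl); lia.
      apply: overtaken_end => //; first lia.
      by move=> r rN pr; have := bl r rN pr; rewrite whole //; lia.
    have nvt : last_of u <> t.+1.
      by move=> e; have := st_letter S vN; rewrite fv e lt -e (negPf nl).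
    have [|y yv ly] := @up_after p (last_of u) ltac:(lia); first lia.
    have [x xN fx] := st_surj S (y := y) ltac:(lia).
    have lx : letter P x by rewrite -(st_letter S xN) fx.
    have [plx xl nlx _ _] := last_ofP k0 xN lx; have lN : 0 < last_of x <= N by lia.
    have := step_mono_right lN nlx.
    have := st_right S lN nlx; have := st_up S xN lx => fxx flx slx.
    exists (last_of x); split=> //=.
      by rewrite plx; case: (stepP xN) => -[e1 e2 ->]; lia.
    move=> r rN pr; have := bl r rN pr; have := whole r rN pr.
    by case: (stepP rN) => -[e1 e2 ->]; lia.
  left; split.
    move=> x xN px; have fx := whole x xN px.
    case: (stepP xN) => -[e1 e2 ->] //.
      by case/eqP: ps; rewrite -px -e1 fx.
    have := partner_up xN e2; rewrite px => ux; rewrite -ux fu in e1; lia.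
  have r1 := rights_eq p (m := u) ltac:(lia); have r2 := rights_eq p' (m := u) ltac:(lia).
  have u1 := up' (m := u) ltac:(lia); have v1 := up' (m := last_of u) ltac:(lia).
  case: (boolP (s <= last_of u <= t)) => c; last by rewrite (negPf c) in v1; lia.
  have sv : last_of u <> s by move=> e; rewrite -e pl eqxx in ps.
  have := inside_block vN (y := u) ltac:(lia) uN; rewrite pl paru => /(_ erefl) [su _].
  by have e : s <= u <= t by [lia]; rewrite e c in u1 v1; lia.
right.
have lx0 : ~~ letter P x0.
  by apply/negP => l; case: fx0; rewrite -(partner_up x0N l) px0.
have notin x : 0 < x <= N -> par x = u -> s < f x <= t -> False.
  by move=> xN px fx; have := inside_block xN fx x0N; rewrite px0 px => /(_ erefl) [].
have pr'N : 0 < par r' <= N by have [] := partnerP P r'N; lia.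
split.
  exists x0 => //; split=> //; have := step_mono_right x0N lx0; have := st_right S x0N lx0; lia.
case: (boolP (s < f r' <= t)) => c.
  have [xs xsN fxs] := st_surj S (y := s) ltac:(lia).
  case: (eqVneq (par xs) u) => [pxs|npxs].
    apply: overtaken_end => //.
      have := bl xs xsN pxs; have lxs : ~~ letter P xs by rewrite -(st_letter S xsN) fxs.
      have := st_right S xsN lxs; rewrite fxs; have := partner_right xsN lxs; rewrite pxs; lia.
    by move=> r rN pr; have := fr' r rN pr; lia.
  exists r'; split=> //=.
    have := notin u uN paru; rewrite fu => nu.
    by case: (stepP pr'N) => -[e1 e2 ->]; lia.
  move=> r rN pr; have := fr' r rN pr; have := step_mono_right r'N lr'.
  case: (stepP rN) => -[e1 e2 ->]; try lia.
  by case/eqP: npxs; rewrite -pr; congr par; apply: (st_inj S); rewrite fxs e1.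
exists r'; split=> //=.
  have := notin u uN paru; rewrite fu => nu.
  by case: (stepP pr'N) => -[e1 e2 ->]; lia.
move=> r rN pr; have lt1 := fr' r rN pr; have lt2 := step_mono_right r'N lr'.
have nt : f r' <> t.+1.
  by move=> e; have := st_letter S r'N; rewrite e lt (negPf lr').
apply: leq_trans lt2.
case: (stepP rN) => -[e1 e2 ->]; [rewrite e1 in lt1 | rewrite e1 in lt1 | done]; last by lia.
by clear -c lt1 nt; lia.
Qed.

Lemma state_step : state p' f'.
Proof.
have [s1 st tN] := step_bounds.
split.
- exact: tile_state_step T (st_tiles S) on up'.
- move=> q qN.
  have d m : m <= N -> depth P p' m = depth P p m + (s <= m <= t).
    move=> mN; rewrite /depth up' //; have [le _] := st_tiles S; have := le m mN; lia.
  rewrite !d; try lia.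
  case: (boolP (s < q <= t)) => qs.
    by rewrite inside_fixed // /exchange !ifF //; lia.
  have [_ _ cl] := T.
  case: (eqVneq q s) => [e|ns].
    subst q; have -> : (s <= s.-1 <= t) = false by lia.
    rewrite leqnn st addn0 addn1 => e [] // /=.
    by rewrite step_depth ?leqnn ?st // joined_sym => /cl; lia.
  case: (eqVneq q t.+1) => [e|nt].
    subst q; rewrite /= st leqnn.
    have -> : (s <= t.+1 <= t) = false by lia.
    rewrite step_depth ?leqnn ?st // addn1 addn0 => <- [] //= /(max_tile_closed T).
    by move=> /(_ ltac:(lia)); lia.
  have -> : (s <= q.-1 <= t) = false by lia.
  have -> : (s <= q <= t) = false by lia.
  rewrite !addn0 => e1 e2; rewrite (st_fix S qN e1 e2).
  by rewrite /exchange (negPf ns) (negPf nt).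
- by move=> x y /(can_inj (exchangeK _ _))/(st_inj S).
- by move=> x xN; have := st_range S xN; case: (stepP xN) => -[_ _ ->]; lia.
- move=> y yN; have [|x xN fx] := st_surj S (y := exchange s t.+1 y).
    by rewrite /exchange; case: eqP; [|case: eqP]; lia.
  by exists x => //; rewrite fx exchangeK.
- move=> x xN; rewrite step_letter ?exchangeK ?(st_letter S) //.
  by have := st_range S xN; case: (stepP xN) => -[_ _ ->]; lia.
- by move=> x xN lx; rewrite (leq_trans (step_mono_up xN lx)) ?(st_up S).
- by move=> x xN lx; rewrite (leq_trans (st_right S xN lx)) ?step_mono_right.
- move=> u uN lu pu; have [fv ph] := st_free S uN lu pu.
  have [_ ul _ _ _] := last_ofP k0 uN lu; have vN : 0 < last_of u <= N by lia.
  have [vs vt] := free_fixed uN lu pu.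
  split; first by case: (stepP vN) => -[e1 e2 ->]; lia.
  case: ph => [fx|se]; last by right; apply: sealed_step.
  case: (boolP ((u <= s <= last_of u) || (u <= t.+1 <= last_of u))) => touch.
    by right; apply: sealed_step => //; apply: seal S _ _ _ _ => //; apply: free_touched.
  left=> x xu; have xN : 0 < x <= N by lia.
  by have := fx x xu; case: (stepP xN) => -[e1 e2 ->]; lia.
exact: pinned_step.
Qed.

End Step.

(** What remains of the invariant when all tiles have been added: up steps fill
1, ..., n and right steps the rest. *)
Definition settled (f : nat -> nat) : Prop :=
  [/\ injective f,
      forall y, 0 < y <= N -> exists2 x, 0 < x <= N & f x = y,
      forall x, 0 < x <= N -> letter P x -> 0 < f x <= n /\ f x <= x,
      forall x, 0 < x <= N -> ~~ letter P x -> n < f x <= N /\ x <= f x &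
      forall u, 0 < u <= N -> letter P u ->
        [/\ f (last_of u) = last_of u,
            forall r, 0 < r <= N -> ~~ letter P r -> last_of u < f r -> f (par r) < f u &
            forall r0 r, 0 < r0 <= N -> 0 < r <= N -> ~~ letter P r0 -> ~~ letter P r ->
              par r0 = u -> f r0 < f r < last_of u -> f u <= f (par r)] \/
        f u = u /\ overtaken f u].

Lemma state_settled p f : state p f -> region_above p = set0 -> settled f.
Proof.
move=> S r0; have up m : m <= N -> ups p m = minn m n by apply: region0_ups.
have le y : 0 < y <= N -> letter p y = (y <= n).
  case: y => // y yN; have := @ups_stepP _ _ p y ltac:(lia); rewrite !up; try lia.
  by case=> -[l e _]; lia.
have vN u : 0 < u <= N -> letter P u -> [/\ 0 < last_of u <= N, u < last_of u & ~~ letter P (last_of u)].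
  by move=> uN lu; have [_ ul nl _ _] := last_ofP k0 uN lu; split=> //; lia.
have fl x : 0 < x <= N -> letter P x = (f x <= n).
  by move=> xN; rewrite -(st_letter S xN) le // (st_range S).
split.
- exact: st_inj S.
- exact: st_surj S.
- by move=> x xN lx; rewrite -fl // lx (st_up S) //; have := st_range S xN; lia.
- move=> x xN lx; rewrite (st_right S) //; have := st_range S xN.
  by rewrite fl // in lx; lia.
move=> u uN lu; have [lN ul nl] := vN u uN lu.
case: (boolP (pinned u)) => pu.
  right; have [fu ph] := st_pinned S uN lu pu; split=> //.
  case: ph => [[whole]|[]//]; rewrite up; last lia.
  have [pl _ _ _ _] := last_ofP k0 uN lu.
  by rewrite fl // whole // in nl; lia.
left; have [fv ph] := st_free S uN lu pu; split=> //.
  case: ph => [fx|[]//].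
  have nu : n <= ups p (last_of u) by rewrite up; [rewrite fl // fv in nl; lia | lia].
  by case: (seal S uN lu nu fx).
case: ph => [fx|[]//].
have nu : n <= ups p (last_of u) by rewrite up; [rewrite fl // fv in nl; lia | lia].
by case: (seal S uN lu nu fx).
Qed.

Lemma add_tiles_settled p B ds B' f : add_tiles p B ds B' -> state p f ->
  (forall d, d \in ds -> d \in Dmax P) ->
  (forall b, b \in region_above p -> exists2 d, d \in ds & b \in d) ->
  B = [seq [seq f x | x <- b] | b <- matching P] ->
  exists2 f', settled f' & B' = [seq [seq f' x | x <- b] | b <- matching P].
Proof.
move=> ad; elim: ad f => {p B ds B'} [p B f S _ cov -> |p p' d ds i j B B' ad so ri _ IH f S sub cov eB].
  exists f => //; apply: state_settled S _; apply/setP => b; rewrite in_set0.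
  by apply/negP => /cov[].
have /DmaxP[j0 [s [t [T ed]]]] : d \in Dmax P by apply: sub; rewrite mem_head.
subst d; have [on up'] := add_tile_ups T ad.
have [ei ls] := southmost_start T so; have [ej lt] := rightmost_end k0 T ri; subst i j.
have S' := state_step S T on ls lt up'.
apply: IH S' _ _ _.
- by move=> d dds; apply: sub; rewrite inE dds orbT.
- move=> b; have [_ ->] := ad; rewrite in_setD => /andP[nb /cov[d]].
  by rewrite inE => /orP[/eqP->|dds bd]; [rewrite (negPf nb) | exists d].
by rewrite eB /exchange_blocks -map_comp; apply: eq_map => b /=; rewrite -map_comp.
Qed.

End Labels.


Lemma count_sub_in (T : eqType) (a b : pred T) (s : seq T) :
  {in s, forall x, a x -> b x} -> count a s <= count b s.
Proof.
move=> ab; rewrite -(@eq_in_count _ (predI a b)) ?sub_count // => x => [/andP[]|xs] //=.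
by case: (boolP (a x)) => // /(ab x xs) ->.
Qed.

(** * Row lengths of the image *)

Section Rows.
Variables k n : nat.
Notation N := (k.+1 * n).
Variable P : dyck k n.
Notation par := (partner P).
Notation last_of := (last_of P).
Variable f : nat -> nat.
Hypothesis F : settled P f.

Let B := [seq [seq f x | x <- b] | b <- matching P].

Lemma par_range x : 0 < x <= N -> 0 < par x <= N.
Proof. by move=> xN; have [] := partnerP P xN; lia. Qed.

Lemma set_inj : injective f. Proof. by case: F. Qed.

Lemma set_surj y : 0 < y <= N -> exists2 x, 0 < x <= N & f x = y.
Proof. by case: F => _ H _ _ _; apply: H. Qed.

Lemma set_up x : 0 < x <= N -> letter P x -> 0 < f x <= n /\ f x <= x.
Proof. by case: F => _ _ H _ _; apply: H. Qed.

Lemma set_right x : 0 < x <= N -> ~~ letter P x -> n < f x <= N /\ x <= f x.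
Proof. by case: F => _ _ _ H _; apply: H. Qed.

Lemma set_par x : 0 < x <= N -> 0 < f (par x) <= n.
Proof.
by move=> xN; case: (set_up (par_range xN) (partner_letter P xN)).
Qed.

Lemma n_le_N : n <= N. Proof. by rewrite mulSn leq_addr. Qed.

Lemma label_up l : 0 < l <= n -> exists u, [/\ 0 < u <= N, letter P u & f u = l].
Proof.
move=> ln; have nN := n_le_N; have [|x xN fx] := @set_surj l; first lia.
exists x; split=> //; apply/negPn/negP => /(set_right xN); lia.
Qed.

Lemma label_right j : n < j <= N -> exists r, [/\ 0 < r <= N, ~~ letter P r & f r = j].
Proof.
move=> jn; have [|x xN fx] := @set_surj j; first lia.
by exists x; split=> //; apply/negP => /(set_up xN); lia.
Qed.

Definition top (l : nat) : nat :=
  \max_(r < N.+1 | [&& 0 < r, ~~ letter P r & l <= f (par r)]) f r.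

Lemma top_ge l r : 0 < r <= N -> ~~ letter P r -> l <= f (par r) -> f r <= top l.
Proof.
move=> rN lr lp; have rN' : r < N.+1 by lia.
pose A := [pred r : 'I_N.+1 | [&& 0 < r, ~~ letter P r & l <= f (par r)]].
have := @leq_bigmax_cond _ A (fun r : 'I_N.+1 => f r) (Ordinal rN').
by apply; rewrite /= lr lp; lia.
Qed.

Hypothesis k0 : 0 < k.

Lemma last_right u : 0 < u <= N -> letter P u ->
  [/\ 0 < last_of u <= N, ~~ letter P (last_of u) & par (last_of u) = u].
Proof. by move=> uN lu; have [? ? ? _ _] := last_ofP k0 uN lu; split=> //; lia. Qed.

Lemma block_of_label u : 0 < u <= N -> letter P u ->
  nth [::] B (find (fun T => f u \in T) B) = [seq f x | x <- block P u].
Proof.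
move=> uN lu; set a := fun T : seq nat => f u \in T.
have BE : B = [seq [seq f x | x <- block P v] | v <- rev (up_positions P)].
  by rewrite /B matching_blocks // -map_comp.
have hB : has a B.
  apply/hasP; exists [seq f x | x <- block P u].
    by rewrite BE; apply: map_f; rewrite mem_rev mem_up_positions uN.
  by apply: map_f; rewrite mem_block uN partner_up ?eqxx.
have := nth_find [::] hB; have : nth [::] B (find a B) \in B by rewrite mem_nth // -has_find.
set T' := nth _ _ _; rewrite BE => /mapP[v _ ->]; rewrite /a => /mapP[x].
rewrite mem_block => /andP[xN /eqP px] /set_inj e; subst x.
by rewrite -px partner_up.
Qed.

Lemma SprimeE u : 0 < u <= N -> letter P u ->
  Sprime B (f u) = [seq f r | r <- right_positions P & par r == u].
Proof.
move=> uN lu; rewrite /Sprime block_of_label // block_cons //= eqxx /=.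
apply/all_filterP/allP => y /mapP[r]; rewrite mem_filter mem_right_positions.
case/andP=> _ /andP[rN lr] ->; apply/eqP => /set_inj e.
by rewrite e lu in lr.
Qed.

Lemma SprimeP l y : 0 < l <= n -> reflect
  (exists r, [/\ 0 < r <= N, ~~ letter P r, f (par r) = l & y = f r]) (y \in Sprime B l).
Proof.
move=> ln; apply: (iffP idP) => [|[r [rN lr <- ->]]]; last first.
  rewrite SprimeE ?par_range ?partner_letter //; apply: map_f.
  by rewrite mem_filter mem_right_positions rN lr eqxx.
have [u [uN lu <-]] := label_up ln; rewrite SprimeE // => /mapP[r].
rewrite mem_filter mem_right_positions => /andP[/eqP pr /andP[rN lr]] ->.
by exists r; rewrite pr.
Qed.

Lemma size_Sprime l : 0 < l <= n -> size (Sprime B l) = k /\ uniq (Sprime B l).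
Proof.
move=> ln; have [u [uN lu fu]] := label_up ln; rewrite -fu SprimeE // size_map.
split; first by have := size_block k0 uN lu; rewrite block_cons //= => -[].
by rewrite map_inj_uniq ?filter_uniq ?iota_uniq //; apply: set_inj.
Qed.

(** The position j carries a right step with label at most l. *)
Definition low (l j : nat) : bool := has (fun l' => j \in Sprime B l') (iota 1 l).

Lemma lowP l j : l <= n -> reflect
  (exists r, [/\ 0 < r <= N, ~~ letter P r, f (par r) <= l & j = f r]) (low l j).
Proof.
move=> ln; apply: (iffP hasP) => [[l']|[r [rN lr lp ->]]].
  rewrite mem_iota => l'l /SprimeP [|r [rN lr e ->]]; first lia.
  by exists r; rewrite e; split=> //; lia.
have := set_par rN => pN; exists (f (par r)); first by rewrite mem_iota; lia.
by apply/SprimeP => //; exists r.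
Qed.

Lemma count_low l : l <= n -> count (low l) (iota 1 N) = l * k.
Proof.
elim: l => [|l IHl] ln; first by rewrite (eq_count (a2 := pred0)) ?count_pred0.
have e : low l.+1 =1 predU (low l) (mem (Sprime B l.+1)).
  by move=> j; rewrite /low -[X in iota _ X]addn1 iotaD has_cat /= orbF add1n.
have := count_predUI (low l) (mem (Sprime B l.+1)) (iota 1 N).
rewrite (eq_count e) IHl ?(ltnW ln) //.
have -> : count (predI (low l) (mem (Sprime B l.+1))) (iota 1 N) = 0.
  apply/eqP; rewrite -leqn0 leqNgt -has_count; apply/negP => /hasP[j _ /andP[]] /=.
  move=> /(lowP _ (ltnW ln)) [r [rN lr lp ->]] /SprimeP [|r' [rN' lr' lp' /set_inj er]]; first lia.
  by subst r'; lia.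
have [sz us] := @size_Sprime l.+1 ltac:(lia).
have -> : count (mem (Sprime B l.+1)) (iota 1 N) = k.
  rewrite -size_filter -[RHS]sz; apply/perm_size/uniq_perm => //.
    by rewrite filter_uniq ?iota_uniq.
  move=> j; rewrite mem_filter mem_iota add1n ltnS /=.
  case: (boolP (j \in _)) => //= /SprimeP [|r [rN lr lp ->]]; first lia.
  by have := set_right rN lr; lia.
by rewrite mulSn; lia.
Qed.

Lemma yrowE l : 0 < l <= n -> yrow k n B (n + 1 - l) =
  count (fun j => low l.-1 j && (min_seq (Sprime B l) <= j)) (iota 1 N).
Proof.
move=> ln; rewrite /yrow /kappa.
have -> : n - (n + 1 - l) = l.-1 by lia.
have -> : n + 1 - (n + 1 - l) = l by lia.
rewrite -(@count_low l.-1) ?leq_pred //; last lia.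
set s := iota 1 N; set m := min_seq _.
have -> : count (low l.-1) s = count (fun j => low l.-1 j && (j < m)) s +
                               count (fun j => low l.-1 j && (m <= j)) s.
  rewrite -size_filter -(count_predC (fun j => j < m)) !count_filter.
  by congr (_ + _); apply: eq_count => j /=; rewrite -?leqNgt andbC.
exact: addKn.
Qed.

Lemma topP l : 0 < l <= n -> exists z,
  [/\ 0 < z <= N, ~~ letter P z, l <= f (par z) & f z = top l].
Proof.
move=> ln; have [u [uN lu fu]] := label_up ln; have [vN lv pv] := last_right uN lu.
have vN' : last_of u < N.+1 by lia.
pose A := [pred r : 'I_N.+1 | [&& 0 < r, ~~ letter P r & l <= f (par r)]].
have [|z] := @eq_bigmax_cond _ A (fun r : 'I_N.+1 => f r).
  by apply/card_gt0P; exists (Ordinal vN'); rewrite inE /= lv pv fu; lia.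
rewrite inE => /and3P[z0 lz lp] e; exists z; split=> //.
by rewrite z0 -ltnS ltn_ord.
Qed.

Lemma top_range l : 0 < l <= n -> n < top l <= N.
Proof. by move=> /topP[z [zN lz lp <-]]; case: (set_right zN lz). Qed.

Lemma top_mono l l' : 0 < l <= l' -> l' <= n -> top l' <= top l.
Proof.
move=> ll ln; have [|z [zN lz lp <-]] := @topP l'; first lia.
by apply: top_ge => //; lia.
Qed.

(** The two kinds of blocks in terms of [top]: at a block with unmoved last right
step [top] jumps to this step, at an overtaken one it does not change. *)
Lemma label_cases u : 0 < u <= N -> letter P u ->
  [/\ f (last_of u) = last_of u, top (f u) = last_of u,
      f u < n -> top (f u).+1 < top (f u) &
      (forall r, 0 < r <= N -> ~~ letter P r -> last_of u < f r -> f (par r) < f u) /\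
      (forall r0 r, 0 < r0 <= N -> 0 < r <= N -> ~~ letter P r0 -> ~~ letter P r ->
        par r0 = u -> f r0 < f r < last_of u -> f u <= f (par r))] \/
  [/\ f u = u, u < n, top u = top u.+1 &
      forall r, 0 < r <= N -> ~~ letter P r -> par r = u -> f r < top u.+1].
Proof.
move=> uN lu; have [vN lv pv] := last_right uN lu; have [fuN _] := set_up uN lu.
have [_ _ _ _ /(_ u uN lu)] := F; case=> [[fv C1 C2]|[fu [r' [rN' lr' pr' fr']]]].
  have tE : top (f u) = last_of u.
    apply/eqP; rewrite eqn_leq -{2}fv top_ge ?pv // andbT.
    have [z [zN lz lp <-]] := topP fuN.
    by rewrite leqNgt; apply/negP => /(C1 z zN lz); lia.
  left; split=> // fun'; rewrite ltn_neqAle top_mono ?andbT; try lia.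
  have [|z [zN lz lp <-]] := @topP (f u).+1; first lia.
  apply/eqP; rewrite tE -fv => /set_inj e.
  by rewrite e pv ltnn in lp.
right; have := set_par rN' => pN.
have lt_top r : 0 < r <= N -> ~~ letter P r -> par r = u -> f r < top u.+1.
  move=> rN lr pr; apply: leq_trans (fr' r rN pr) _.
  by apply: top_ge => //.
have un : u < n by lia.
split=> //; apply/eqP; rewrite eqn_leq andbC top_mono /=; try lia.
have [|z [zN lz lp <-]] := @topP u; first lia.
case: (eqVneq (par z) u) => [pz|npz]; first by apply: ltnW; apply: lt_top.
apply: top_ge => //; rewrite ltn_neqAle lp andbT; apply/eqP => e.
by case/eqP: npz; apply: set_inj; rewrite fu.
Qed.

Lemma min_Sprime u : 0 < u <= N -> letter P u ->
  exists r0, [/\ 0 < r0 <= N, ~~ letter P r0, par r0 = u, f r0 = min_seq (Sprime B (f u)) &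
                 f r0 <= f (last_of u)].
Proof.
move=> uN lu; have [fuN _] := set_up uN lu; have [vN lv pv] := last_right uN lu.
have : min_seq (Sprime B (f u)) \in Sprime B (f u).
  apply: min_seq_mem; have [] := size_Sprime fuN; case: (Sprime _ _) => // e.
  by move: k0; rewrite -e.
case/SprimeP => // r0 [r0N lr0 /set_inj pr0 e].
exists r0; split=> //; rewrite -e; apply: min_seq_le.
by apply/SprimeP => //; exists (last_of u); rewrite pv.
Qed.

Lemma count_gt m : m <= N -> count (fun j => m < j) (iota 1 N) = N - m.
Proof.
move=> mN; have -> : iota 1 N = iota 1 m ++ iota m.+1 (N - m).
  have {1}-> : N = m + (N - m) by lia.
  by rewrite iotaD add1n.
rewrite count_cat (eq_in_count (a2 := pred0)) ?count_pred0; last first.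
  by move=> x; rewrite mem_iota /=; lia.
rewrite (eq_in_count (a2 := predT)) ?count_predT ?size_iota //.
by move=> x; rewrite mem_iota /=; lia.
Qed.

(** In the first case the right steps with lower labels that come after the first
right step of u are exactly those beyond its last one; in the second case there
are at least those beyond [top]. *)
Lemma yrow_cases u : 0 < u <= N -> letter P u ->
  yrow k n B (n + 1 - f u) = N - top (f u) \/
  [/\ f u < n, top (f u) = top (f u).+1 & N - top (f u) <= yrow k n B (n + 1 - f u)].
Proof.
move=> uN lu; have [fuN _] := set_up uN lu; have [vN lv pv] := last_right uN lu.
have [r0 [r0N lr0 pr0 er0 le0]] := min_Sprime uN lu.
rewrite yrowE // -er0; have ln : (f u).-1 <= n by lia.
case: (label_cases uN lu) => [[fv tE _ [C1 C2]]|[fu un tE lt_top]].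
  left; rewrite tE -count_gt; last lia.
  apply: eq_in_count => j; rewrite mem_iota => jN.
  apply/andP/idP => [[/(lowP _ ln) [r [rN lr lp ->]] le]|vj].
    rewrite ltnNge; apply/negP => rv.
    have npr : par r <> u by move=> e; rewrite e in lp; lia.
    have nv : f r <> last_of u by rewrite -fv => /set_inj e; rewrite e in npr.
    have n0 : f r0 <> f r by move=> /set_inj e; rewrite -e in npr.
    by have := C2 r0 r r0N rN lr0 lr pr0; lia.
  have nv := set_right vN lv.
  have [|r [rN lr fr]] := @label_right j; first lia.
  rewrite -fr in vj *; have := C1 r rN lr vj => lp.
  split; last by lia.
  by apply/lowP => //; exists r; split=> //; lia.
right; rewrite fu in ln le0 *; split=> //.
have tN := @top_range u.+1 ltac:(lia).
rewrite tE -count_gt; last lia.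
apply: count_sub_in => j; rewrite mem_iota => jN tj.
have [|r [rN lr fr]] := @label_right j; first lia.
rewrite -fr in tj *; have l0 := lt_top r0 r0N lr0 pr0.
apply/andP; split; last by lia.
apply/lowP => //; exists r; split=> //.
have npr : par r <> u by move=> /(lt_top r rN lr); lia.
have nf : f (par r) <> u by move=> e; apply: npr; apply: set_inj; rewrite fu.
have : ~ (u < f (par r)) by move=> /(top_ge rN lr); lia.
lia.
Qed.

(** The overtaken labels do not change the running minimum. *)
Lemma ymax_top i : 0 < i <= n -> ymax k n B i = N - top (n + 1 - i).
Proof.
elim: i => // -[|i] IH iN.
  have [|u [uN lu fu]] := @label_up n; first lia.
  rewrite /ymax; have -> : n + 1 - 1 = f u by lia.
  have {1}-> : 1 = n + 1 - f u by lia.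
  by case: (yrow_cases uN lu) => // -[]; lia.
have {}IH := IH ltac:(lia).
have -> : ymax k n B i.+2 = minn (ymax k n B i.+1) (yrow k n B i.+2) by [].
rewrite IH.
have [|u [uN lu fu]] := @label_up (n + 1 - i.+2); first lia.
have e : n + 1 - i.+1 = (f u).+1 by lia.
have e2 : i.+2 = n + 1 - f u by lia.
rewrite e -fu e2.
have le := @top_mono (f u) (f u).+1 ltac:(lia) ltac:(lia).
have t1 := @top_range (f u) ltac:(lia).
by case: (yrow_cases uN lu) => [->|[_ e3 c]]; lia.
Qed.

End Rows.


(** * Mat cuts out the rotated blocks *)

Section Stages.
Variables k n : nat.
Notation N := (k.+1 * n).
Hypothesis n0 : 0 < n.

(** Rotation of the positions by n - 1 steps to the left. *)
Definition rho (x : nat) : nat := if n <= x then x.+1 - n else (x + N).+1 - n.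

Lemma rho_range x : 0 < x <= N -> 0 < rho x <= N.
Proof. by move=> xN; have := n_le_N k n; rewrite /rho; case: ifP; lia. Qed.

Lemma rho_inj x y : 0 < x <= N -> 0 < y <= N -> rho x = rho y -> x = y.
Proof. by move=> xN yN; have := n_le_N k n; rewrite /rho; case: ifP; case: ifP; lia. Qed.

Lemma rho_surj y : 0 < y <= N -> exists2 x, 0 < x <= N & rho x = y.
Proof.
move=> yN; have := n_le_N k n => nN.
exists (if y + n <= N.+1 then y + n - 1 else y + n - N.+1); rewrite /rho; case: (ifP (y + n <= _));
  try (case: ifP); lia.
Qed.

Lemma map_rho_low a m : a + m <= n -> [seq rho x | x <- iota a m] = iota ((a + N).+1 - n) m.
Proof.
elim: m a => //= m IHm a am; rewrite IHm; last lia.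
have -> : rho a = (a + N).+1 - n by rewrite /rho ifF //; lia.
by congr (_ :: iota _ _); have := n_le_N k n; lia.
Qed.

Lemma map_rho_high a m : n <= a -> [seq rho x | x <- iota a m] = iota (a.+1 - n) m.
Proof.
elim: m a => //= m IHm a am; rewrite IHm; last lia.
have -> : rho a = a.+1 - n by rewrite /rho ifT //; lia.
by congr (_ :: iota _ _); lia.
Qed.

Lemma cyclic_up u : 0 < u < n ->
  cyclic_from N (rho u, true) = [seq rho x | x <- iota u (N - u).+1 ++ iota 1 u.-1].
Proof.
move=> un; have nN := n_le_N k n; rewrite -[LHS]/(rot (rho u).-1 (iota 1 N)).
have -> : (N - u).+1 = (n - u) + (N.+1 - n) by lia.
rewrite iotaD !map_cat map_rho_low; last lia.
rewrite (map_rho_high (N.+1 - n)); last lia.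
rewrite map_rho_low; last lia.
rewrite /rot drop_iota take_iota -catA; congr (iota _ _ ++ _).
- by rewrite /rho ifF; lia.
- by rewrite /rho ifF; lia.
have -> : minn (rho u).-1 N = (N.+1 - n) + u.-1 by rewrite /rho ifF; lia.
by rewrite iotaD; congr (iota _ _ ++ iota _ _); lia.
Qed.

Lemma cyclic_down v : n <= v <= N ->
  cyclic_from N (rho v, false) = [seq rho x | x <- rev (iota 1 v) ++ rev (iota v.+1 (N - v))].
Proof.
move=> vN; have nN := n_le_N k n; rewrite -[LHS]/(rev (rot (rho v) (iota 1 N))).
rewrite -rev_cat map_rev; congr rev.
have -> : iota 1 v = iota 1 n.-1 ++ iota n (v.+1 - n).
  have {1}-> : v = n.-1 + (v.+1 - n) by lia.
  by rewrite iotaD; congr (_ ++ iota _ _); lia.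
rewrite !map_cat map_rho_high; last lia.
rewrite map_rho_low; last lia.
rewrite map_rho_high //; rewrite /rot drop_iota take_iota catA.
have er : rho v = v.+1 - n by rewrite /rho ifT //; lia.
rewrite er; congr (_ ++ iota _ _); try lia.
have -> : N - (v.+1 - n) = (N - v) + n.-1 by lia.
by rewrite iotaD; congr (iota _ _ ++ iota _ _); lia.
Qed.

Hypothesis k0 : 0 < k.
Variable P : dyck k n.
Notation par := (partner P).
Notation last_of := (last_of P).
Variable f : nat -> nat.
Hypothesis F : settled P f.
Variable Q : dyck k n.
Hypothesis rowsQ : forall i, 1 <= i <= n ->
  row_length Q (n - i) = ymax k n [seq [seq f x | x <- b] | b <- matching P] i.
Notation top := (top P f).

Lemma row_top l : 0 < l <= n -> row_length Q l.-1 = N - top l.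
Proof.
move=> ln; have := rowsQ (i := n + 1 - l) ltac:(lia).
rewrite (ymax_top F k0); last lia.
have -> : n - (n + 1 - l) = l.-1 by lia.
by have -> : n + 1 - (n + 1 - l) = l by lia.
Qed.

(** The row with label l is preceded by a right step iff it is longer than the next
lower row. In coordinates rotated back by [rho], its block starts at [top l] and
goes down in this case, and starts at l - 1 and goes up otherwise. *)
Lemma mat_startE l : 0 < l <= n -> mat_start Q (n + 1 - l) =
  if (1 < l) && (top l < top l.-1) then ((top l).+1 - n, false) else (N + l - n, true).
Proof.
move=> ln; have tl := top_range F k0 ln.
have upP l' : 0 < l' <= n -> let u := nth 0 (up_positions Q) l'.-1 in
    [/\ 0 < u <= N, letter Q u, ups Q u.-1 = l'.-1, ups Q u = l' & rights Q u.-1 = N - top l'].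
  move=> ln' u; have [] := @nth_up_positionsP _ _ Q l'.-1 ltac:(lia).
  by rewrite -/u => uN lu e1 e2; split=> //; [lia | rewrite -row_top].
rewrite /mat_start /row_up nth_rev size_up_positions; last lia.
have -> : n - (n + 1 - l).-1.+1 = l.-1 by lia.
have [uN lu e1 e2 e3] := upP l ln; set u := nth _ _ _ in uN lu e1 e2 e3 *.
rewrite -[count_mem _ _]/(rights Q u.-1) e3.
have -> : (1 < u) && (letter Q u.-1 == right) = (1 < l) && (top l < top l.-1).
  case: (ltngtP 1 l) => [l1|l1|el]; [|lia|]; last first.
    have r1 := rights_eq Q (m := u.-1) ltac:(lia).
    have t1 : top 1 = N.
      have N0 : 0 < N by lia.
      have [|r [rN lr fr]] := label_right F (j := N); first by rewrite mulSn; lia.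
      have := top_ge (P := P) (f := f) (l := 1) rN lr; have := set_par F rN.
      by rewrite -el in tl; lia.
    by rewrite -el t1 subnn in e3; have -> : (1 < u) = false by lia.
  have [vN lv f1 f2 f3] := upP l.-1 ltac:(lia); set v := nth _ _ _ in vN lv f1 f2 f3 *.
  have u1 : 1 < u.
    rewrite ltnNge; apply/negP => u1; have e : u = 1 by lia.
    by rewrite e /= ups0 in e1; lia.
  have tl' := top_range F k0 (l := l.-1) ltac:(lia).
  rewrite u1 /=; have vu : v <= u.-1.
    by rewrite leqNgt; apply/negP => uv; have := @leq_ups Q u.-1 v.-1 ltac:(lia); lia.
  have := leq_rights Q (m1 := v.-1) (m2 := u.-2) ltac:(lia).
  have uN2 : u.-2 < N by lia.
  case: (ups_stepP Q uN2) => -[l' e4 e5]; rewrite prednK in l' e4 e5; try lia.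
    rewrite l' /= => le; apply/esym/negbTE; rewrite -leqNgt.
    have : nth 0 (up_positions Q) (ups Q u.-2) = u.-1 by apply: nth_up_positions; try lia.
    have -> : ups Q u.-2 = l.-2 by lia.
    by rewrite -/v => ev; rewrite ev -e5 in f3; lia.
  have -> : (letter Q u.-1 == right) = true by rewrite (negPf l').
  by move=> le; apply/esym; lia.
case: ifP => _; congr (_, _); last lia.
have : N = n + k * n by rewrite mulSn.
lia.
Qed.

(** If the other blocks nested in the block of b have been removed, then the k + 1
successive elements from either end of it are its elements. *)
Lemma successive_block c I b seg rest : 0 < b <= N -> letter P b ->
  cyclic_from N c = [seq rho x | x <- seg ++ rest] -> uniq seg ->
  (forall z, (z \in seg) = (b <= z <= last_of b)) ->
  (forall z, b <= z <= last_of b -> (rho z \in I) = (par z == b)) ->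
  forall z, 0 < z <= N -> (rho z \in successive k N I c) = (par z == b).
Proof.
move=> bN lb cE useg segE inI z zN.
have [pl bl _ _ [_ blk]] := last_ofP k0 bN lb.
rewrite /successive cE filter_map -map_take filter_cat.
set s := filter _ seg.
have sE : s = [seq x <- seg | par x == b].
  by apply: eq_in_filter => x; rewrite segE => xb /=; apply: inI.
have sm x : (x \in s) = (0 < x <= N) && (par x == b).
  rewrite sE mem_filter segE andbC; case: eqP => [px|_]; last by rewrite !andbF.
  rewrite !andbT; apply/idP/idP => [|xN]; first lia.
  exact: blk.
have sz : size s = k.+1.
  rewrite -(size_block k0 bN lb); apply/perm_size/uniq_perm.
  - by rewrite filter_uniq.
  - by rewrite filter_uniq ?iota_uniq.
  by move=> x; rewrite sm mem_block.
rewrite -sz take_size_cat //; apply/mapP/idP => [[x]|pz].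
  by rewrite sm => /andP[xN /eqP px] /(rho_inj zN xN) ->; rewrite px.
by exists z; rewrite // sm zN.
Qed.

Definition is_block (T : seq nat) : Prop :=
  exists b, forall z, 0 < z <= N -> (rho z \in T) = (par z == b).

(** The block that carries the last right step with label at least l. It is the
only one with such a label that is left when the row with label l is reached. *)
Definition leading (l b : nat) : Prop :=
  [/\ 0 < b <= N, letter P b, l <= f b &
      [/\ last_of b = top l, f (last_of b) = last_of b &
      forall r, 0 < r <= N -> ~~ letter P r -> last_of b < f r -> f (par r) < f b]].

Lemma leading_good u : 0 < u <= N -> letter P u -> f (last_of u) = last_of u ->
  top (f u) = last_of u ->
  (forall r, 0 < r <= N -> ~~ letter P r -> last_of u < f r -> f (par r) < f u) ->
  leading (f u) u.
Proof. by move=> uN lu fv tE C1; split. Qed.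

Lemma not_nested b z : 0 < b <= N -> letter P b -> b <= z <= last_of b -> par z <> b ->
  [/\ 0 < par z <= N, letter P (par z), b < par z, last_of (par z) < last_of b &
      last_of b <= f (last_of b)].
Proof.
move=> bN lb zb pz; have [pl bl nl _ _] := last_ofP k0 bN lb.
have zN : 0 < z <= N by lia.
have lz : last_of b <= f (last_of b) by have := set_right F (x := last_of b) ltac:(lia) nl; lia.
have zlt : b < z < last_of b.
  case: (eqVneq z b) => [e|n1]; first by case: pz; rewrite e partner_up.
  by case: (eqVneq z (last_of b)) => [e|n2]; [case: pz; rewrite e | lia].
have [p1 p2] := noncrossing k0 bN lb zlt pz; split=> //.
  exact: par_range.
exact: partner_letter.
Qed.

(** At each row one block of P disappears, and the remaining ones are those with
label below l and the leading one. If l - 1 is overtaken, its up step is at l - 1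
and its block is removed; otherwise the leading block is removed and l - 1 leads
next. No remaining block is nested in the one removed. The leading one ends too far
to the right. Any other one would have its up step beyond its label, hence its
last right step unmoved, but the outer block has a higher label and ends beyond
this step. *)
Lemma stages l I b : l <= n ->
  (0 < l -> leading l b /\
    forall z, 0 < z <= N -> (rho z \in I) = (f (par z) < l) || (par z == b)) ->
  forall T, T \in mat_blocks_from k N I [seq mat_start Q i | i <- iota (n + 1 - l) l] ->
  is_block T.
Proof.
elim: l I b => // l IHl I b ln /(_ isT) [[bN lb lfb [tb fb Cb]] inI] T.
rewrite /= inE => H; move: H; set T0 := successive _ _ _ _.
have -> : (n + 1 - l.+1).+1 = n + 1 - l by lia.
set I' := filter _ I.
have nN := n_le_N k n.
have tl := top_range F k0 (l := l.+1) ltac:(lia).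
(* Reduction to finding the block T0 that is removed and the next leading block c. *)
have next b' c : (forall z, 0 < z <= N -> (rho z \in T0) = (par z == b')) ->
    (0 < l -> leading l c /\ forall z, 0 < z <= N ->
       ((f (par z) < l.+1) || (par z == b)) && (par z != b') = (f (par z) < l) || (par z == c)) ->
    (T == T0) || (T \in mat_blocks_from k N I' [seq mat_start Q i | i <- iota (n + 1 - l) l]) ->
    is_block T.
  move=> T0E Hc /orP[/eqP->|]; first by exists b'.
  apply: (IHl I' c); first lia.
  move=> /Hc [lc Hz]; split=> // z zN.
  by rewrite mem_filter T0E // inI // andbC Hz.
have T0c : T0 = successive k N I (mat_start Q (n + 1 - l.+1)) by [].
have mE := mat_startE (l := l.+1) ltac:(lia); rewrite /= in mE.
case: (posnP l) => [l0|l1].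
  apply: (next b b); last by rewrite l0.
  move=> z zN; rewrite T0c /successive take_oversize.
    rewrite mem_filter (perm_mem (cyclic_from_perm _ _)) inI // mem_iota.
    have := rho_range zN; have := set_par F zN; rewrite l0; lia.
  have szb : size [seq rho x | x <- block P b] = k.+1 by rewrite size_map size_block.
  rewrite -[X in _ <= X]szb; apply: uniq_leq_size.
    by rewrite filter_uniq // (perm_uniq (cyclic_from_perm _ _)) iota_uniq.
  move=> x; rewrite mem_filter (perm_mem (cyclic_from_perm _ _)) mem_iota => /andP[xI xN].
  have [|y yN ey] := @rho_surj x; first lia.
  rewrite -ey in xI *; apply: map_f; rewrite mem_block yN /=.
  by have := set_par F yN; rewrite inI // l0 in xI; lia.
have [|u [uN lu fu]] := label_up F (l := l); first lia.
have [vN lv pv] := last_right k0 uN lu.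
case: (label_cases F k0 uN lu) => [[fv tE tlt [C1 C2]]|[fu' un tE ltt]].
  have c : top l.+1 < top l by rewrite -fu; apply: tlt; lia.
  apply: (next b u); last first.
    move=> _; split; first by rewrite -fu; apply: leading_good.
    move=> z zN; rewrite ltnS leq_eqVlt -fu.
    case: (eqVneq (par z) b) => [->|npb] /=.
      by have -> : b == u = false by [apply/eqP => e; rewrite e in lfb; lia]; lia.
    rewrite orbF andbT orbC; congr (_ || _).
    apply/eqP/eqP => [/(set_inj F)//|->//].
  move=> z zN; apply: (@successive_block _ _ b (rev (iota b (last_of b - b).+1))
      (rev (iota 1 b.-1) ++ rev (iota (last_of b).+1 (N - last_of b)))) => //.
  - have [_ bl _ _ _] := last_ofP k0 bN lb.
    have -> : mat_start Q (n + 1 - l.+1) = (rho (top l.+1), false).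
      by rewrite mE c ltnS l1 /rho ifT //; lia.
    rewrite cyclic_down; last lia.
    rewrite -tb catA -[rev (iota b _) ++ _]rev_cat; congr map; congr (rev _ ++ _).
    have {1}-> : last_of b = b.-1 + (last_of b - b).+1 by lia.
    by rewrite iotaD; congr (_ ++ iota _ _); lia.
  - by rewrite rev_uniq iota_uniq.
  - move=> x; rewrite mem_rev mem_iota; have [_ bl _ _ _] := last_ofP k0 bN lb; lia.
  move=> x xb; have [_ bl _ _ _] := last_ofP k0 bN lb; rewrite inI; last lia.
  case: (eqVneq (par x) b) => [_|npx]; first by rewrite orbT.
  rewrite orbF; apply/negbTE/negP => fx; move/eqP: npx => npx.
  have [cN lc bc ccl _] := not_nested bN lb xb npx.
  have [wN lw pw] := last_right k0 cN lc; have := set_up F bN lb.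
  case: (label_cases F k0 cN lc) => [[fw _ _ [D1 _]]|[fc _ _ _]]; last by lia.
  have [vbN lvb pvb] := last_right k0 bN lb.
  by have := D1 _ vbN lvb; rewrite pvb fb; lia.
have c : top l.+1 = top l by rewrite -fu fu' tE.
have bu : b <> u by move=> e; rewrite e in lfb; lia.
apply: (next u b); last first.
  move=> _; split; first by split=> //; [lia | rewrite -c].
  move=> z zN; rewrite ltnS leq_eqVlt.
  case: (eqVneq (par z) b) => [->|npb] /=; first by rewrite !orbT; apply/eqP.
  rewrite !orbF -{1}fu; case: (eqVneq (par z) u) => [->|npu].
    by rewrite fu ltnn andbF.
  by rewrite andbT; case: eqP => // /(set_inj F) e; rewrite e eqxx in npu.
move=> z zN; apply: (@successive_block _ _ u (iota u (last_of u - u).+1)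
    (iota (last_of u).+1 (N - last_of u) ++ iota 1 u.-1)) => //.
- have [_ ul _ _ _] := last_ofP k0 uN lu.
  rewrite mE c ltnn andbF; have -> : N + l.+1 - n = rho u by rewrite /rho ifF; lia.
  rewrite cyclic_up; last lia.
  rewrite catA; congr map; congr (_ ++ _).
  have -> : (N - u).+1 = (last_of u - u).+1 + (N - last_of u) by lia.
  by rewrite iotaD; congr (_ ++ iota _ _); lia.
- exact: iota_uniq.
- move=> x; rewrite mem_iota; have [_ ul _ _ _] := last_ofP k0 uN lu; lia.
move=> x xu; have [_ ul _ _ _] := last_ofP k0 uN lu; rewrite inI; last lia.
case: (eqVneq (par x) u) => [->|/eqP npx]; first by rewrite fu ltnS leqnn.
have [cN lc bc ccl vle] := not_nested uN lu xu npx.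
have [wN lw pw] := last_right k0 cN lc.
have eu : u = l := etrans (esym fu') fu.
have lv_top := ltt _ vN lv pv; rewrite {2}eu in lv_top.
case: (eqVneq (par x) b) => [e|npb]; first by rewrite e tb in ccl; lia.
rewrite orbF; apply/negbTE/negP => fx.
have nfx : f (par x) <> l by rewrite -fu => /(set_inj F).
case: (label_cases F k0 cN lc) => [[fw _ _ [D1 _]]|[fc _ _ _]]; last by lia.
by have := D1 _ vN lv; rewrite pv fu; lia.
Qed.

Lemma mat_blocks_is_block T : T \in mat_blocks Q -> is_block T.
Proof.
have nN := n_le_N k n.
rewrite /mat_blocks; have -> : iota 1 n = iota (n + 1 - n) n by rewrite addKn.
have [|b [bN lb fb]] := label_up F (l := n); first lia.
case: (label_cases F k0 bN lb) => [[fv tE _ [C1 _]]|[]]; last by lia.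
apply: (stages (b := b)) => // _; split; first by rewrite -fb; apply: leading_good.
move=> z zN; rewrite mem_iota; have := rho_range zN => rN.
have := set_par F zN => /andP[_]; rewrite leq_eqVlt => /orP[/eqP e|->]; last by lia.
have -> : par z = b by apply: (set_inj F); rewrite e fb.
by rewrite eqxx orbT; lia.
Qed.

Lemma iter_turn m x : m < N -> 0 < x <= N ->
  iter m (turn k n) x = if m < x then x - m else x + N - m.
Proof.
elim: m => [|m IHm] mN xN; first by rewrite subn0; case: ifP => //; lia.
rewrite iterS IHm //; last lia.
by rewrite /turn; case: (ltnP m x) => c1; case: eqP => e; case: (ltnP m.+1 x) => c2; lia.
Qed.

Lemma rho_turn x : 0 < x <= N -> rho x = iter (n - 1) (turn k n) x.
Proof.
move=> xN; have nN := n_le_N k n; rewrite iter_turn //; last lia.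
by rewrite /rho; case: ifP; case: ifP; lia.
Qed.

Lemma turn_range x : 0 < x <= N -> 0 < turn k n x <= N.
Proof. by move=> xN; rewrite /turn; case: eqP; lia. Qed.

Lemma partner_iter m x y : 0 < x <= N -> 0 < y <= N ->
  let p := iter m (@promotion_fun k n) P in
  (partner p (iter m (turn k n) x) == partner p (iter m (turn k n) y)) = (par x == par y).
Proof.
move=> xN yN; elim: m => //= m <-.
have R z : 0 < z <= N -> 0 < iter m (turn k n) z <= N.
  by move=> zN; elim: m => //= m IHm; apply: turn_range.
by apply: partner_promotion => //; apply: R.
Qed.

(** Both words have their up steps at the minima of the rotated blocks. *)
Lemma Mat_promotion : Mat Q = iter (n - 1) (@promotion_fun k n) P.
Proof.
set p := iter _ _ _.
have same x y : 0 < x <= N -> 0 < y <= N ->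
    (partner p (rho x) == partner p (rho y)) = (par x == par y).
  by move=> xN yN; rewrite !rho_turn //; apply: partner_iter.
have [zB pB aB] : [/\ size (mat_blocks Q) = n, perm_eq (flatten (mat_blocks Q)) (iota 1 N)
                    & all (fun T => size T == k.+1) (mat_blocks Q)].
  have [] // := @mat_blocks_fromP k N (iota 1 N) [seq mat_start Q i | i <- iota 1 n].
  - exact: iota_uniq.
  - by rewrite !size_iota size_map size_iota.
  by rewrite size_map size_iota.
have minT T : T \in mat_blocks Q -> min_seq T \in T /\ exists2 z, 0 < z <= N & rho z = min_seq T.
  move=> TB; have mT : min_seq T \in T by apply: min_seq_mem; have := allP aB T TB; case: (T).
  split=> //; apply: rho_surj.
  have : min_seq T \in flatten (mat_blocks Q) by apply/flattenP; exists T.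
  by rewrite (perm_mem pB) mem_iota; lia.
have blk T z z' : T \in mat_blocks Q -> rho z \in T -> 0 < z <= N -> 0 < z' <= N ->
    (rho z' \in T) = (par z' == par z).
  move=> TB zT zN zN'; have [b bE] := mat_blocks_is_block TB.
  by have := zT; rewrite !bE // => /eqP ->.
apply/val_inj/val_inj/(@eq_from_nth _ right); rewrite ?size_tuple // => i iN.
rewrite -[RHS]/(letter p i.+1) [LHS](nth_map 0) ?size_iota // nth_iota // add1n.
have iN' : 0 < i.+1 <= N by lia.
rewrite (letter_partner p iN'); have [z zN ez] := rho_surj iN'; rewrite -ez.
have : rho z \in flatten (mat_blocks Q).
  by rewrite (perm_mem pB) mem_iota; have := rho_range zN; lia.
case/flattenP => T TB zT; have [mT [m mN em]] := minT T TB.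
have mz : par m == par z by rewrite -(blk T z m TB zT) // em.
have [pz _ _] := partnerP p (rho_range zN); have [pm _ _] := partnerP p (rho_range mN).
have ple : rho m <= rho z by rewrite em min_seq_le.
have pp : partner p (rho m) = partner p (rho z) by apply/eqP; rewrite same.
have inT : partner p (rho z) \in T.
  have [|y yN ey] := @rho_surj (partner p (rho z)); first by have := rho_range zN; lia.
  rewrite -ey (blk T z y TB zT) // -same // ey partner_idem //; exact: rho_range.
have eqm : partner p (rho z) = rho m.
  apply/eqP; rewrite eqn_leq {2}em min_seq_le // andbT -pp; lia.
rewrite eqm; case: (eqVneq (rho m) (rho z)) => e.
  by rewrite ifT // -e em; apply: map_f.
rewrite ifF //; apply/negP => /mapP[T' TB' ezT'].
have [mT' _] := minT T' TB'; rewrite -ezT' in mT'.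
have mzT : rho m \in T' by rewrite (blk T' z m TB' mT').
have le := min_seq_le mzT; rewrite -ezT' in le.
by case/eqP: e; apply/eqP; rewrite eqn_leq ple le.
Qed.

End Stages.


(** * The correspondence is a bijection *)

Lemma count_initial (a : pred nat) n : (forall y y', y <= y' < n -> a y' -> a y) ->
  forall y, y < n -> a y = (y < count a (iota 0 n)).
Proof.
move=> ca y yn; have -> : iota 0 n = iota 0 y ++ y :: iota y.+1 (n - y.+1).
  have {1}-> : n = y + (n - y.+1).+1 by lia.
  by rewrite iotaD.
rewrite count_cat /=; case ay: (a y).
  have -> : count a (iota 0 y) = y.
    rewrite -[RHS](size_iota 0) -count_predT; apply: eq_in_count => z.
    by rewrite mem_iota => zy; rewrite (ca z y) //; lia.
  by apply/esym; lia.
have -> : count a (iota y.+1 (n - y.+1)) = 0.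
  rewrite -(count_pred0 (iota y.+1 (n - y.+1))); apply: eq_in_count => z.
  rewrite mem_iota => zy; apply/negP => az.
  by rewrite (ca y z) // in ay; lia.
by have := count_size a (iota 0 y); rewrite size_iota; lia.
Qed.

Section PathOfRows.
Variables k n : nat.
Notation N := (k.+1 * n).
Variable r : nat -> nat.
Hypothesis r_mono : forall y y', y <= y' < n -> r y <= r y'.
Hypothesis r_le : forall y, y < n -> r y <= y * k.

Let pos := [seq (r y + y).+1 | y <- iota 0 n].

Lemma sorted_pos : sorted ltn pos.
Proof.
rewrite (sorted_pairwise ltn_trans) pairwise_map.
apply: (@sub_in_pairwise _ [pred y | y < n] ltn).
- move=> y y'; rewrite !inE => yn yn' /= lt.
  by have := r_mono (y := y) (y' := y') ltac:(lia); lia.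
- by apply/allP => y; rewrite mem_iota.
by rewrite -(sorted_pairwise ltn_trans) iota_ltn_sorted.
Qed.

Lemma pos_range x : x \in pos -> 0 < x <= N.
Proof.
case/mapP => y; rewrite mem_iota => yn ->; have := r_le (y := y) ltac:(lia).
have := leq_mul (leqnn k.+1) (_ : y.+1 <= n) => /(_ ltac:(lia)).
by rewrite mulnS (mulnC k.+1 y) mulnS; lia.
Qed.

Lemma path_of_rows : exists Q : dyck k n, forall y, y < n -> row_length Q y = r y.
Proof.
pose w := [tuple of [seq x \in pos | x <- iota 1 N]].
have lw x : 0 < x <= N -> letter w x = (x \in pos).
  by case: x => // x xN; rewrite {1}/letter (nth_map 0) ?size_iota // nth_iota // add1n.
have uw : up_positions w = pos.
  apply: (irr_sorted_eq ltn_trans ltnn).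
  - by rewrite (sorted_filter ltn_trans) ?iota_ltn_sorted.
  - exact: sorted_pos.
  move=> x; rewrite mem_filter mem_iota size_tuple add1n ltnS.
  case: (boolP (0 < x <= N)) => xN; first by rewrite lw // andbT; case: (x \in pos).
  by rewrite andbF; apply/esym/negbTE/negP => /pos_range; apply/negP.
have upsw m : m <= N -> ups w m = count (fun y => r y + y < m) (iota 0 n).
  move=> mN; rewrite ups_count ?size_tuple //.
  rewrite -[RHS](count_map (fun y => (r y + y).+1) (fun x => x <= m)) -/pos -!size_filter.
  apply/perm_size/uniq_perm; rewrite ?filter_uniq ?iota_uniq //.
    exact: (sorted_uniq ltn_trans ltnn sorted_pos).
  move=> x; rewrite !mem_filter mem_iota add1n ltnS.
  case: (boolP (0 < x <= m)) => xm.
    by case/andP: (xm) => _ ->; rewrite andbT lw //; lia.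
  rewrite andbF; apply/esym/negbTE/andP => -[xm' /pos_range]; lia.
have init m : forall y, y < n -> (r y + y < m) = (y < count (fun y => r y + y < m) (iota 0 n)).
  apply: count_initial => y y' yy; have := r_mono yy; lia.
have dw : is_kdyck k n w.
  apply: dyck_of_ups => [|m mN].
    rewrite upsw // -[RHS](size_iota 0) -count_predT; apply: eq_in_count => y.
    rewrite mem_iota => yn; have := @pos_range (r y + y).+1.
    by rewrite map_f ?mem_iota // => /(_ isT) /=; lia.
  have := ups_rights (w := w) (m := m); rewrite size_tuple => /(_ mN).
  rewrite upsw //; set c := count _ _.
  have cn : c <= n by rewrite -[n](size_iota 0) count_size.
  case: (ltngtP c n) cn => // [cn|e] _ ur.
    have := init m c cn; rewrite -/c ltnn; have := r_le cn; rewrite mulnC; lia.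
  have eN : N = n + k * n by [rewrite mulSn]; rewrite e in ur *; lia.
exists (Dyck dw) => y yn; rewrite -[LHS]/(rights w (nth 0 (up_positions w) y).-1) uw.
rewrite (nth_map 0) ?size_iota // nth_iota // add0n succnK.
have yN : r y + y <= N by have := @pos_range (r y + y).+1; rewrite map_f ?mem_iota // => /(_ isT); lia.
have := ups_rights (w := w) (m := r y + y); rewrite size_tuple => /(_ yN); rewrite upsw //.
set c := count _ _; have := init (r y + y) y yn; rewrite ltnn -/c.
case: (posnP y) => y0; first by lia.
have := init (r y + y) y.-1; rewrite -/c; have := r_mono (y := y.-1) (y' := y) ltac:(lia); lia.
Qed.

End PathOfRows.

Section Graph.
Variables k n : nat.
Notation N := (k.+1 * n).
Hypothesis k0 : 0 < k.
Hypothesis n0 : 0 < n.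

Lemma RSKinv_graph_Mat (P Q : dyck k n) : RSKinv_graph P Q ->
  Mat Q = iter (n - 1) (@promotion_fun k n) P.
Proof.
case=> D [ds [B [mD [uds dsD] ad rows]]].
have eD := maximal_unique mD; subst D.
have [|b bP||f F eB] := add_tiles_settled k0 ad (state0 P).
- by move=> d; rewrite dsD.
- move: bP; rewrite -(cover_partition (Dmax_partition P)) => /bigcupP[d dD bd].
  by exists d; rewrite ?dsD.
- by rewrite (eq_map (fun b => map_id b)) map_id.
by apply: (Mat_promotion n0 k0 F) => i iN; rewrite rows // eB.
Qed.

Lemma ymax_le B i : 0 < i -> ymax k n B i <= (n - i) * k.
Proof.
by case: i => // -[|i] _; rewrite ?geq_min /= /yrow ?leq_subr ?orbT.
Qed.

Lemma ymax_mono B i i' : 0 < i <= i' -> ymax k n B i' <= ymax k n B i.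
Proof.
case/andP=> i0 /subnKC <-; elim: (i' - i) => [|m IHm]; first by rewrite addn0.
by rewrite addnS; case: i i0 IHm => // i _ IHm; apply: leq_trans IHm; apply: geq_minl.
Qed.

Lemma RSKinv_graph_total (P : dyck k n) : exists Q, RSKinv_graph P Q.
Proof.
have [ds [uds dsE dsB]] := add_order_exists k0 (tile_state0 P).
have [B' aB] := dsB (matching P).
have [|y yn|Q rQ] := @path_of_rows k n (fun y => ymax k n B' (n - y)).
- by move=> y y' yy; apply: ymax_mono; lia.
- by have := ymax_le B' (i := n - y) ltac:(lia); rewrite subKn // ltnW.
exists Q, (Dmax P), ds, B'; split=> //; first exact: Dmax_maximal.
  split=> // d; rewrite dsE inE andb_idr // => dM.
  by rewrite -(cover_partition (Dmax_partition P)) bigcup_sup.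
by move=> i iN; rewrite rQ; [congr ymax; lia | lia].
Qed.

End Graph.

Theorem proposition7p24 (k n : nat) (hk : 2 <= k) (hn : 1 <= n) :
  exists RSKinv RSK : dyck k n -> dyck k n,
    [/\ forall P Q : dyck k n, RSKinv_graph P Q <-> RSKinv P = Q,
        cancel RSKinv RSK /\ cancel RSK RSKinv &
        RSK =1 (promotion k n ^- (n - 1))%g \o @Mat k n].
Proof.
have k0 : 0 < k by apply: ltnW.
have [g gP] := fin_all_exists (RSKinv_graph_total k0 hn).
have iterE P : iter (n - 1) (@promotion_fun k n) P = (promotion k n ^+ (n - 1))%g P.
  by rewrite permX; apply: eq_iter => p; rewrite permE.
have MatE P Q : RSKinv_graph P Q -> Mat Q = (promotion k n ^+ (n - 1))%g P.
  by move/(RSKinv_graph_Mat k0 hn) ->; apply: iterE.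
have g_inj : injective g.
  by move=> P P' e; apply: (@perm_inj _ (promotion k n ^+ (n - 1))%g); rewrite -!(MatE _ _ (gP _)) e.
have [g' gK g'K] := injF_bij g_inj.
exists g, g'; split=> //.
- move=> P Q; split=> [PQ|<-//].
  rewrite -[Q]g'K; congr g; apply: (@perm_inj _ (promotion k n ^+ (n - 1))%g).
  by rewrite -(MatE _ _ PQ) -{1}[Q]g'K (MatE _ _ (gP _)).
move=> Q /=; rewrite -{2}[Q]g'K (MatE _ _ (gP _)).
by rewrite permK.
Qed.
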